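(* Let $\tau\ge0$, let $m_t$ be the median of $L_t^{(\tau)}$ and define $$x^*(u,t)=\inf_{s>0}\left\{\frac{\ln(tV(W))+t\kappa_d\delta_t^d(e^s-1)}{2t\kappa_d\delta_t^ds}+\sqrt{\frac{u^2}{8t^2\kappa_d^2\delta_t^{2d+\tau}(u+m_t)s}+\bigg(\frac{\ln(tV(W))+t\kappa_d\delta_t^d(e^s-1)}{2t\kappa_d\delta_t^ds}\bigg)^2}\,\right\}.$$ Then, for $u>0$, $$\mathbb{P}(|L_t^{(\tau)}-m_t|\ge u)\le8\exp\left(-\frac{u^2}{8t\kappa_d\delta_t^{d+\tau}x^*(u,t)(u+m_t)}\right)$$ and, in particular, $$\mathbb{P}(|L_t^{(\tau)}-m_t|\ge u)\le8\exp\left(-\min\bigg\{\frac{u^2}{C_{t,W}(u+m_t)},\frac{u}{D_t\sqrt{u+m_t}}\bigg\}\right)$$ with $C_{t,W}=16\big(\ln(tV(W))\,\delta_t^\tau+2t\kappa_d\delta_t^{d+\tau}\big)$ and $D_t=4\sqrt{2\delta_t^\tau}$.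
   Context: Fix an integer $d\ge 1$. $W\subset\mathbb{R}^d$ is a compact convex set with volume (Lebesgue measure) $V(W)>0$. For $t>0$, $\eta_t$ is a homogeneous Poisson point process in $W$ with intensity $t$ (identified with the random finite set of its points), and $(\delta_t:t>0)$ is a family of positive real numbers with $\delta_t\to0$ as $t\to\infty$. $\eta^2_{t,\neq}$ is the set of ordered pairs of distinct points of $\eta_t$, and $$L^{(\tau)}_t:=\frac12\sum_{(x,y)\in\eta^2_{t,\neq}}\mathbf{1}(\|x-y\|\le\delta_t)\,\|x-y\|^\tau .$$ $\kappa_d$ is the volume of the $d$-dimensional unit ball. A median $m$ of a random variable $X$ satisfies $\mathbb{P}(X\le m)\ge\frac12$ and $\mathbb{P}(X\ge m)\ge\frac12$. *)

(* Defs.v *)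
From HB Require Import structures.
From mathcomp Require Import all_boot all_order all_algebra finmap.
From mathcomp Require Import all_classical all_reals all_analysis.

Set Implicit Arguments.
Unset Strict Implicit.
Unset Printing Implicit Defensive.

Import Order.TTheory GRing.Theory Num.Theory.
Import numFieldNormedType.Exports.

Local Open Scope classical_set_scope.
Local Open Scope ring_scope.

(* The library norm `|x| on 'rV[R]_d is the sup norm; its topology, which is
   the one used by [compact] and [open] below, is the Euclidean one. *)
Definition enorm (R : realType) (d : nat) (x : 'rV[R]_d) : R :=
  Num.sqrt (\sum_(i < d) x 0 i ^+ 2).

Definition borel (R : realType) (d : nat) : set (set 'rV[R]_d) :=
  <<s [set U : set 'rV[R]_d | open U] >>.

(* Lebesgue measure on 'rV[R]_d (for Borel sets): the d-fold product of
   one-dimensional Lebesgue measure. The recursive clause is the library's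
   product measure [lebesgue_measure \x volume d'], i.e. the integral of the
   measures of the sections, transported along R * R^d' = R^(1 + d'). *)
Fixpoint volume (R : realType) (d : nat) : set 'rV[R]_d -> \bar R :=
  match d with
  | 0%N => fun A => (\1_A (0 : 'rV[R]_0))%:E
  | d'.+1 => fun A =>
      (\int[@lebesgue_measure R]_x
         volume [set y : 'rV[R]_d' |
                 A (row_mx (const_mx x : 'rV[R]_1) y : 'rV[R]_(1 + d'))])%E
  end.

Definition kappa (R : realType) (d : nat) : R :=
  fine (volume [set x : 'rV[R]_d | enorm x <= 1]).

Definition npoints (R : realType) (d : nat) (X : {fset 'rV[R]_d})
    (B : set 'rV[R]_d) : nat :=
  #|` [fset x in X | x \in B]%fset |.

(* [poisson_prob r _ K] is the probability that a Poisson variable with mean r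
   (the constant 0 if r = 0) lies in K; its second argument is unused. *)
Record poisson_process (R : realType) (d : nat) (disp : measure_display)
    (T : measurableType disp) (P : probability T R)
    (W : set 'rV[R]_d) (t : R) (eta : T -> {fset 'rV[R]_d}) : Prop := {
  pp_support : forall w x, x \in eta w -> W x;
  pp_measurable : forall B, borel B ->
    measurable_fun [set: T] (fun w => npoints (eta w) B);
  pp_poisson : forall B, borel B -> forall K : set nat,
    P [set w | K (npoints (eta w) B)] =
    poisson_prob (t * fine (volume (B `&` W))) 0%N K;
  pp_independent : forall (n : nat) (B : 'I_n -> set 'rV[R]_d),
    (forall i, borel (B i)) -> trivIset [set: 'I_n] B ->
    forall K : 'I_n -> set nat,
    P [set w | forall i, K i (npoints (eta w) (B i))] =
    (\prod_(i < n) P [set w | K i (npoints (eta w) (B i))])%E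
}.

Definition edge_length (R : realType) (d : nat) (tau delta : R)
    (X : {fset 'rV[R]_d}) : R :=
  2^-1 * \sum_(x <- X) \sum_(y <- X | x != y)
           (enorm (x - y) <= delta)%R%:R * enorm (x - y) `^ tau.

Definition is_median (R : realType) (disp : measure_display)
    (T : measurableType disp) (P : probability T R) (X : T -> R) (m : R) :
    Prop :=
  ((2^-1)%:E <= P [set w | (X w <= m)%R])%E /\
  ((2^-1)%:E <= P [set w | (m <= X w)%R])%E.

(* Here V stands for V(W), k for kappa_d, delta for delta_t and m for m_t. *)
Definition xstar (R : realType) (d : nat) (tau V k t delta m u : R) : R :=
  let a s := (ln (t * V) + t * k * delta ^+ d * (expR s - 1)) /
             (2 * t * k * delta ^+ d * s) in
  inf [set a s + Num.sqrt
         (u ^+ 2 / (8 * t ^+ 2 * k ^+ 2 * delta `^ ((2 * d)%:R + tau) *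
                    (u + m) * s)
          + a s ^+ 2)
      | s in [set s : R | 0 < s]].

(* Main.v *)
Require Import Defs.
From HB Require Import structures.
From mathcomp Require Import all_boot all_order all_algebra finmap.
From mathcomp Require Import all_classical all_reals all_analysis.
From mathcomp Require Import measurable_realfun ring lra.

Set Implicit Arguments.
Unset Strict Implicit.
Unset Printing Implicit Defensive.

Import Order.TTheory GRing.Theory Num.Theory.
Import numFieldNormedType.Exports.

Local Open Scope classical_set_scope.
Local Open Scope ring_scope.

(** Write L for the edge functional, H = delta ^ tau for the largest weight of
    an edge and lam = t * kappa * delta ^ d, which bounds the mean number of
    points in a ball of radius delta.

    L is quadratic in the set of points, and passing from a configuration x to
    a configuration y can decrease it by at most the sum, over the points of x
    missing from y, of their weighted degrees in x. If every point of x has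
    fewer than B neighbours, the squares of these degrees sum to at most
    2 * H * B * L(x), because the degrees are at most H * B and sum to 2 * L(x).
    A configuration with b <= L and small degrees is therefore at convex
    distance at least (b - a) / sqrt (2 * H * B * b) from the set where
    L <= a, and Talagrand's inequality gives
      P(L <= a) * P(b <= L and all degrees < B)
        <= exp (- (b - a)^2 / (8 * H * B * b)).
    A union bound over the points and a Chernoff bound for the number of
    neighbours show that some degree reaches B with probability at most
      q = t * V(W) * exp (- s * B + lam * (exp s - 1))   for every s >= 0,
    so P(L <= a) * (P(b <= L) - q) is bounded by the same exponential; this is
    [poisson_edge_length_tail]. Taking (a, b) = (m, m + u) and
    (a, b) = (m - u, m) bounds both tails around a median m
    ([median_deviation]). The choice B = lam * x, with x the positive root of a
    quadratic equation, makes q equal to the exponential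
    ([chernoff_balance]); the infimum over s of these roots is xstar. The
    second bound comes from the root at s = 1 alone ([min_exponent]).

    Talagrand's inequality is needed only for finitely many independent
    Bernoulli variables. The set W is cut into finitely many small disjoint
    Borel cells; whether a cell contains a point of the process is an event of
    probability 1 - exp (- t * volume of the cell), and these events are
    independent ([prob_occupied]). The functional and the degree bound make
    sense for the graph on the occupied cells ([bernoulli_graph_tail],
    [cells_tail]). When the cells shrink, every given configuration ends up with
    at most one point per cell, so the discrete functionals converge to L
    pointwise ([total_weight_cvg]), and the tail inequality passes to the limit
    ([tail_limit]).

    Talagrand's inequality itself is proved in transport form
    ([talagrand_transport]): E (exp h) * E (exp (- g)) <= 1 as soon as h x is at
    most the sum of w y * g y plus a quarter of the sum over i of
    w (y i != x i) ^ 2, for all x and all probability weights w. This form is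
    stable under products, so that an induction reduces it to one coordinate.

    The volume, defined by iterated integration, is shown to coincide on Borel
    sets with a sigma-finite measure ([volume_measure]), and its behaviour under
    homotheties ([volume_affine]) gives the volume of all Euclidean balls. *)

(** * Talagrand's inequality for Bernoulli product measures *)

(** Both values dominate the tangent to the exponential at the mean point. *)
Lemma expR_convex2 (R : realType) (l a b : R) : 0 <= l <= 1 ->
  expR ((1 - l) * a + l * b) <= (1 - l) * expR a + l * expR b.
Proof.
move=> /andP[l0 l1]; set m := (1 - l) * a + l * b.
have tangent x : expR m * (1 + (x - m)) <= expR x.
  rewrite [leRHS](_ : _ = expR m * expR (x - m));
    last by rewrite -expRD addrC subrK.
  rewrite ler_pM2l ?expR_gt0//.
  exact: expR_ge1Dx.
have -> : expR m = (1 - l) * (expR m * (1 + (a - m))) +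
  l * (expR m * (1 + (b - m))).
  by rewrite /m; ring.
by apply: lerD; apply: ler_wpM2l => //; rewrite subr_ge0.
Qed.

(** The two sides agree at 0, and 2 minus the left side increases there: its
    derivative is nonnegative because exp (D ^ 2 - 2 * D) >= 1 - 2 * D. *)
Lemma expR_sum_le2 (R : realType) (D : R) : 0 <= D <= 2^-1 ->
  expR (D - D ^+ 2) + expR (- D) <= 2.
Proof.
move=> /andP[D0 D2].
pose f (x : R) := - expR (- x) - expR (x - x ^+ 2).
have df (x : R) : is_derive x 1 f
  (expR (- x) - (1 - 2 * x) * expR (x - x ^+ 2)).
  rewrite /f; apply: is_derive_eq; rewrite /GRing.scale/=; ring.
have : f 0 <= f D.
  apply: (@ger0_derive1_le_cc _ _ 0 D); rewrite ?in_itv/= ?lexx ?D0//.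
  - move=> x _; rewrite derive1E derive_val subr_ge0.
    have -> : - x = (- 2 * x + x ^+ 2) + (x - x ^+ 2) by ring.
    rewrite [leRHS]expRD ler_wpM2r ?expR_ge0//.
    apply: le_trans (expR_ge1Dx _); have := sqr_ge0 x; lra.
  - by apply: derivable_within_continuous => x _; apply: ex_derive.
rewrite /f oppr0 expr0n/= subrr expR0; lra.
Qed.

(** Minimising the exponent over m gives m = 1 - 2 * D, which lies in [0, 1]
    only when D <= 1/2; for larger D the boundary value m = 0 is good enough. *)
Lemma talagrand_exponent (R : realType) (D : R) : 0 <= D ->
  exists2 m : R, 0 <= m <= 1 &
    expR (m * D + 4^-1 * (1 - m) ^+ 2) <= 2 - expR (- D).
Proof.
move=> D0; have [D2|D2] := leP D 2^-1.
  exists (1 - 2 * D); first by apply/andP; split; lra.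
  rewrite (_ : _ + _ = D - D ^+ 2); last by field.
  have := @expR_sum_le2 R D; rewrite D0 D2 => /(_ isT); lra.
exists 0; first by rewrite lexx ler01.
rewrite mul0r add0r subr0 expr1n mulr1 lerBrDr.
(* With a = exp (1/4) <= 4/3 the claim a + a ^- 2 <= 2 factors as (a - 1) * (a ^
   2 - a - 1) <= 0. *)
set a := expR (4^-1 : R).
have a1 : 1 <= a by rewrite /a; apply: le_trans (expR_ge1Dx _); lra.
have a4 : a * (3 / 4) <= 1.
  have : 3 / 4 <= a^-1 by rewrite /a -expRN; apply: le_trans (expR_ge1Dx _);
    lra.
  by move/(ler_wpM2l (expR_ge0 4^-1)); rewrite -/a divff ?gt_eqF ?expR_gt0.
have : expR (- D) <= a ^- 2.
  rewrite /a -expRM_natl -expRN ler_expR; lra.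
move=> /le_trans h; apply: (@le_trans _ _ (a + a ^- 2));
  first by rewrite lerD2l h.
have a0 : 0 < a by rewrite expR_gt0.
rewrite -(@ler_pM2r _ (a ^+ 2)) ?exprn_gt0// mulrDl mulVf ?expf_neq0 ?gt_eqF//.
have : (a - 1) * (a ^+ 2 - a - 1) <= 0.
  apply: mulr_ge0_le0; first by rewrite subr_ge0.
  nra.
lra.
Qed.

(** The case of one coordinate. The infimum over l of the bound on h1 replaces
    exp (h1 - g0) by 2 - r with r = exp (g0 - g1), and then the product is 1 -
    (q * (1 - r)) ^ 2. *)
Lemma talagrand_two_point (R : realType) (p q g0 g1 h0 h1 : R) :
  0 <= p -> 0 <= q -> p + q = 1 -> g0 <= g1 -> h0 <= g0 ->
  (forall l, 0 <= l <= 1 -> h1 <= (1 - l) * g1 + l * g0 + 4^-1 * l ^+ 2) ->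
  (p * expR h0 + q * expR h1) * (p * expR (- g0) + q * expR (- g1)) <= 1.
Proof.
move=> p0 q0 pq g01 h0g h1g.
have [m m01 mD] := @talagrand_exponent R (g1 - g0) ltac:(by rewrite subr_ge0).
set r := expR (- (g1 - g0)) in mD.
have r0 : 0 <= r by exact: expR_ge0.
have h1r : expR h1 <= expR g0 * (2 - r).
  apply: (@le_trans _ _ (expR g0 * expR (m * (g1 - g0) + 4^-1 * (1 - m) ^+ 2))).
    rewrite -expRD ler_expR; apply: (le_trans (h1g (1 - m) _)).
      by move: m01 => /andP[? ?]; apply/andP; split; lra.
    by rewrite le_eqVlt; apply/orP; left; apply/eqP; ring.
  by rewrite ler_wpM2l ?expR_ge0.
have E1 : expR (- g1) = expR (- g0) * r by rewrite /r -expRD; congr expR; ring.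
rewrite E1; apply: (@le_trans _ _ ((p * expR g0 + q * (expR g0 * (2 - r))) *
   (p * expR (- g0) + q * (expR (- g0) * r)))).
  apply: ler_wpM2r; first by rewrite addr_ge0// !mulr_ge0// ?expR_ge0.
  by apply: lerD; apply: ler_wpM2l => //; rewrite ler_expR.
have -> : (p * expR g0 + q * (expR g0 * (2 - r))) *
   (p * expR (- g0) + q * (expR (- g0) * r)) =
   (expR g0 * expR (- g0)) * ((p + q * (2 - r)) * (p + q * r)) by ring.
rewrite -expRD subrr expR0 mul1r (_ : p = 1 - q); last by rewrite -pq addrK.
have -> : (1 - q + q * (2 - r)) * (1 - q + q * r) = 1 - (q * (1 - r)) ^+ 2
  by ring.
by rewrite gerBl sqr_ge0.
Qed.

Definition bern (R : realType) (p : R) (b : bool) : R := if b then p else 1 - p.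

Definition bmass (R : realType) (I : finType) (p : I -> R)
    (x : {ffun I -> bool}) : R := \prod_i bern (p i) (x i).

Definition bmean (R : realType) (I : finType) (p : I -> R)
    (f : {ffun I -> bool} -> R) : R := \sum_x bmass p x * f x.

Definition fcons (n : nat) (b : bool) (x : {ffun 'I_n -> bool}) :
    {ffun 'I_n.+1 -> bool} :=
  [ffun i => if unlift ord0 i is Some j then x j else b].

Definition ftail (n : nat) (x : {ffun 'I_n.+1 -> bool}) : {ffun 'I_n -> bool} :=
  [ffun j => x (lift ord0 j)].

Lemma fcons0 n b (x : {ffun 'I_n -> bool}) : fcons b x ord0 = b.
Proof. by rewrite ffunE unlift_none. Qed.

Lemma fconsS n b (x : {ffun 'I_n -> bool}) j : fcons b x (lift ord0 j) = x j.
Proof. by rewrite ffunE liftK. Qed.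

Lemma fconsK n (z : {ffun 'I_n.+1 -> bool}) : fcons (z ord0) (ftail z) = z.
Proof. by apply/ffunP => i; rewrite ffunE; case: unliftP => [j|] ->;
  rewrite ?ffunE. Qed.

Lemma ftailK n b (x : {ffun 'I_n -> bool}) : ftail (fcons b x) = x.
Proof. by apply/ffunP => j; rewrite !ffunE liftK. Qed.

Lemma sum_fcons (R : realType) n (G : {ffun 'I_n.+1 -> bool} -> R) :
  \sum_z G z = \sum_b \sum_y G (fcons b y).
Proof.
rewrite pair_big/= (reindex (fun bx : bool * {ffun 'I_n -> bool} =>
  fcons bx.1 bx.2))//=.
exists (fun z : {ffun 'I_n.+1 -> bool} => (z ord0, ftail z)) =>
  [[b x] _|z _] /=; last exact: fconsK.
by rewrite fcons0 ftailK.
Qed.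

Lemma bmean_fcons (R : realType) n (p : 'I_n.+1 -> R) f :
  bmean p f = \sum_b bern (p ord0) b *
    bmean (fun j => p (lift ord0 j)) (fun y => f (fcons b y)).
Proof.
rewrite /bmean sum_fcons; apply: eq_bigr => b _; rewrite mulr_sumr.
apply: eq_bigr => y _; rewrite mulrA; congr (_ * _).
rewrite /bmass big_ord_recl fcons0; congr (_ * _).
by apply: eq_bigr => j _; rewrite fconsS.
Qed.

Lemma bern_ge0 (R : realType) (p : R) b : 0 <= p <= 1 -> 0 <= bern p b.
Proof. by case: b => /andP[p0 p1] //=; rewrite subr_ge0. Qed.

Lemma bmass_ge0 (R : realType) (I : finType) (p : I -> R) x :
  (forall i, 0 <= p i <= 1) -> 0 <= bmass p x.
Proof. by move=> hp; apply: prodr_ge0 => i _; exact: bern_ge0. Qed.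

Lemma bmean_le (R : realType) (I : finType) (p : I -> R) f g :
  (forall i, 0 <= p i <= 1) -> (forall x, f x <= g x) -> bmean p f <= bmean p g.
Proof. by move=> hp fg; apply: ler_sum => x _;
  rewrite ler_wpM2l ?bmass_ge0. Qed.

Lemma bmean_prod (R : realType) (I : finType) (p : I -> R)
    (phi : I -> bool -> R) :
  bmean p (fun x => \prod_i phi i (x i)) =
  \prod_i ((1 - p i) * phi i false + p i * phi i true).
Proof.
transitivity (\sum_(x : {ffun I -> bool}) \prod_i
  (bern (p i) (x i) * phi i (x i))).
  by apply: eq_bigr => x _; rewrite big_split.
rewrite -(bigA_distr_bigA (fun i b => bern (p i) b * phi i b)).
by apply: eq_bigr => i _; rewrite big_bool addrC.
Qed.

Lemma bmean_cst (R : realType) (I : finType) (p : I -> R) c :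
  bmean p (fun=> c) = c.
Proof.
rewrite /bmean -mulr_suml.
have := bmean_prod p (fun _ _ => 1); rewrite /bmean.
rewrite [X in X = _ -> _](eq_bigr (bmass p)) => [->|x _];
  last by rewrite big1 ?mulr1.
rewrite big1 ?mul1r// => i _; ring.
Qed.

Lemma bmeanD (R : realType) (I : finType) (p : I -> R) f g :
  bmean p (fun x => f x + g x) = bmean p f + bmean p g.
Proof. by rewrite /bmean -big_split; apply: eq_bigr => x _; rewrite mulrDr. Qed.

Lemma bmeanZ (R : realType) (I : finType) (p : I -> R) c f :
  bmean p (fun x => c * f x) = c * bmean p f.
Proof. by rewrite /bmean mulr_sumr; apply: eq_bigr => x _; rewrite mulrCA. Qed.

Lemma bmean_gt0 (R : realType) (I : finType) (p : I -> R) f :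
  (forall i, 0 <= p i <= 1) -> (forall x, 0 < f x) -> 0 < bmean p f.
Proof.
move=> hp f0; have [x0 xm] : exists x0, forall x, f x0 <= f x.
  have [x0 _ h] := @arg_minP _ _ _ [ffun=> false] xpredT f isT.
  by exists x0 => x; exact: h.
by rewrite (lt_le_trans (f0 x0))// -[leLHS](bmean_cst p) bmean_le.
Qed.

Definition is_distr (R : realType) (J : finType) (w : J -> R) : Prop :=
  (forall y, 0 <= w y) /\ \sum_y w y = 1.

(** The cost of moving the point x to the law w: the mean of g under w, plus a
    quarter of the squared length of the vector of probabilities that a
    coordinate has to be changed. For g equal to 0 on a set and infinite off it,
    the smallest cost is a quarter of the squared convex distance to it. *)
Definition transport_cost (R : realType) (I : finType)
    (g : {ffun I -> bool} -> R) (x : {ffun I -> bool})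
    (w : {ffun I -> bool} -> R) : R :=
  \sum_y w y * g y + 4^-1 *
    \sum_i (\sum_(y : {ffun I -> bool} | y i != x i) w y) ^+ 2.

Lemma distr_point (R : realType) (J : finType) (x : J) :
  is_distr (fun y => (y == x)%:R : R).
Proof.
split => [y|]; first by case: (y == x).
by rewrite (bigD1 x)//= eqxx big1 ?addr0// => y /negbTE ->.
Qed.

Lemma transport_cost_ge (R : realType) (I : finType) (g : {ffun I -> bool} -> R)
  x w :
  is_distr w -> - (\sum_y `|g y|) <= transport_cost g x w.
Proof.
move=> [w0 w1]; rewrite -[leLHS]addr0; apply: lerD; last first.
  by rewrite mulr_ge0// ?invr_ge0// sumr_ge0// => i _; exact: sqr_ge0.
rewrite -sumrN; apply: ler_sum => y _.
have wy1 : w y <= 1.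
  by rewrite -w1 (bigD1 y)//= lerDl sumr_ge0.
rewrite lerNl -mulrN; apply: (le_trans (ler_norm _)).
by rewrite normrM normrN ger0_norm// -[leRHS]mul1r ler_wpM2r.
Qed.

Definition opt_transport (R : realType) (I : finType)
    (g : {ffun I -> bool} -> R) (x : {ffun I -> bool}) : R :=
  inf [set transport_cost g x w | w in @is_distr R {ffun I -> bool}].

Lemma opt_transport_has_inf (R : realType) (I : finType)
    (g : {ffun I -> bool} -> R) (x : {ffun I -> bool}) :
  has_inf [set transport_cost g x w | w in @is_distr R {ffun I -> bool}].
Proof.
split; first by exists (transport_cost g x (fun y => (y == x)%:R)),
  (fun y => (y == x)%:R);
  [exact: distr_point|].
by exists (- (\sum_y `|g y|)) => _ [w dw <-]; exact: transport_cost_ge.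
Qed.

Lemma opt_transport_le (R : realType) (I : finType) (g : {ffun I -> bool} -> R)
  x w :
  is_distr w -> opt_transport g x <= transport_cost g x w.
Proof.
by move=> dw; apply: ge_inf; [exact: (opt_transport_has_inf g x).2|exists w].
Qed.

(** Keep the first coordinate b with probability 1 - l and flip it with
    probability l, the other coordinates being drawn from w0 or w1
    accordingly. *)
Definition mix_distr (R : realType) (n : nat) (b : bool) (l : R)
    (w0 w1 : {ffun 'I_n -> bool} -> R) (z : {ffun 'I_n.+1 -> bool}) : R :=
  if z ord0 == b then (1 - l) * w0 (ftail z) else l * w1 (ftail z).

Lemma sum_mix_distr (R : realType) (n : nat) (b : bool) (l : R)
    (w0 w1 : {ffun 'I_n -> bool} -> R) (G : {ffun 'I_n.+1 -> bool} -> R) :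
  \sum_z mix_distr b l w0 w1 z * G z =
  (1 - l) * (\sum_y w0 y * G (fcons b y)) +
    l * (\sum_y w1 y * G (fcons (~~ b) y)).
Proof.
rewrite sum_fcons.
have E c : \sum_y mix_distr b l w0 w1 (fcons c y) * G (fcons c y) =
    if c == b then (1 - l) * (\sum_y w0 y * G (fcons c y))
    else l * (\sum_y w1 y * G (fcons c y)).
  by case: ifPn => cb; rewrite mulr_sumr; apply: eq_bigr => y _;
    rewrite /mix_distr fcons0 ftailK ?cb ?(negbTE cb) mulrA.
by rewrite big_bool/= !E; case: b {E} => //=; rewrite addrC.
Qed.

Lemma sum_cond (R : realType) (J : finType) (P : pred J) (w : J -> R) :
  \sum_(y | P y) w y = \sum_y w y * (P y)%:R.
Proof. by rewrite big_mkcond; apply: eq_bigr => y _;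
  rewrite mulr_natr mulrb. Qed.

Lemma is_distr_mix (R : realType) (n : nat) (b : bool) (l : R)
    (w0 w1 : {ffun 'I_n -> bool} -> R) :
  0 <= l <= 1 -> is_distr w0 -> is_distr w1 -> is_distr (mix_distr b l w0 w1).
Proof.
move=> /andP[l0 l1] [w00 w01] [w10 w11]; split.
  by move=> z; rewrite /mix_distr; case: ifP => _; rewrite mulr_ge0// subr_ge0.
transitivity (\sum_z mix_distr b l w0 w1 z * 1); first by apply: eq_bigr => z _;
  rewrite mulr1.
rewrite (sum_mix_distr b l w0 w1 (fun=> 1)).
transitivity ((1 - l) * \sum_y w0 y + l * \sum_y w1 y).
  by congr (_ * _ + _ * _); apply: eq_bigr => y _; rewrite mulr1.
by rewrite w01 w11; ring.
Qed.

(** Flipping the first coordinate with probability l costs l ^ 2 / 4; on the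
    other coordinates the squares are convex in the law. *)
Lemma transport_cost_mix_distr (R : realType) (n : nat) (b : bool) (l : R)
    (w0 w1 : {ffun 'I_n -> bool} -> R) (g : {ffun 'I_n.+1 -> bool} -> R) x :
  0 <= l <= 1 -> is_distr w0 -> is_distr w1 ->
  transport_cost g (fcons b x) (mix_distr b l w0 w1) <=
  (1 - l) * transport_cost (fun y => g (fcons b y)) x w0 +
  l * transport_cost (fun y => g (fcons (~~ b) y)) x w1 + 4^-1 * l ^+ 2.
Proof.
move=> /andP[l0 l1] [w00 w01] [w10 w11].
rewrite /transport_cost sum_mix_distr big_ord_recl/=.
have -> : \sum_(y : {ffun 'I_n.+1 -> bool} | y ord0 != fcons b x ord0) mix_distr
  b l w0 w1 y = l.
  rewrite sum_cond (sum_mix_distr b l w0 w1 (fun y : {ffun 'I_n.+1 -> bool} =>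
    (y ord0 != fcons b x ord0)%:R)).
  rewrite (eq_bigr (fun=> 0)) => [|y _]; last by rewrite !fcons0 eqxx mulr0.
  rewrite big1// mulr0 add0r (eq_bigr w1) ?w11 ?mulr1// => y _.
  by rewrite !fcons0; case: (b); rewrite mulr1.
set c0 := fun i => \sum_(y : {ffun 'I_n -> bool} | y i != x i) w0 y.
set c1 := fun i => \sum_(y : {ffun 'I_n -> bool} | y i != x i) w1 y.
have E i : \sum_(y : {ffun 'I_n.+1 -> bool} |
  y (lift ord0 i) != fcons b x (lift ord0 i)) mix_distr b l w0 w1 y =
    (1 - l) * c0 i + l * c1 i.
  rewrite sum_cond (sum_mix_distr b l w0 w1
    (fun y : {ffun 'I_n.+1 -> bool} =>
      (y (lift ord0 i) != fcons b x (lift ord0 i))%:R)).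
  pose P (y : {ffun 'I_n -> bool}) := y i != x i.
  by rewrite /c0 /c1 (sum_cond P w0) (sum_cond P w1); congr (_ * _ + _ * _);
    apply: eq_bigr => y _;
    rewrite !fconsS.
have sq i : ((1 - l) * c0 i + l * c1 i) ^+ 2 <= (1 - l) * c0 i ^+ 2 +
  l * c1 i ^+ 2.
  rewrite -subr_ge0.
  have -> : (1 - l) * c0 i ^+ 2 +
    l * c1 i ^+ 2 - ((1 - l) * c0 i + l * c1 i) ^+ 2 =
    ((1 - l) * l) * (c0 i - c1 i) ^+ 2 by ring.
  by rewrite mulr_ge0 ?sqr_ge0// mulr_ge0// subr_ge0.
have le : \sum_i (\sum_(y :
  {ffun 'I_n.+1 -> bool} | y (lift ord0 i) != fcons b x (lift ord0 i))
      mix_distr b l w0 w1 y) ^+ 2 <=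
    (1 - l) * (\sum_i c0 i ^+ 2) + l * (\sum_i c1 i ^+ 2).
  by rewrite !mulr_sumr -big_split; apply: ler_sum => i _; rewrite E sq.
rewrite -/c0 -/c1; lra.
Qed.

Lemma opt_transport_fcons (R : realType) (n : nat) (b : bool) (l : R)
    (h g : {ffun 'I_n.+1 -> bool} -> R) x :
  0 <= l <= 1 -> (forall w, is_distr w -> h (fcons b x) <=
    transport_cost g (fcons b x) w) ->
  h (fcons b x) <= (1 - l) * opt_transport (fun y => g (fcons b y)) x +
    l * opt_transport (fun y => g (fcons (~~ b) y)) x + 4^-1 * l ^+ 2.
Proof.
move=> l01 hg; have /andP[l0 l1] := l01; apply/ler_addgt0Pr => e e0.
have [_ [w0 dw0 <-] lt0] :=
  inf_adherent e0 (opt_transport_has_inf (fun y => g (fcons b y)) x).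
have [_ [w1 dw1 <-] lt1] :=
  inf_adherent e0 (opt_transport_has_inf (fun y => g (fcons (~~ b) y)) x).
apply: (le_trans (hg _ (is_distr_mix b l01 dw0 dw1))).
apply: (le_trans (transport_cost_mix_distr _ _ _ l01 dw0 dw1)).
have /(ler_wpM2l l0) := ltW lt1.
have l1' : 0 <= 1 - l by rewrite subr_ge0.
have /(ler_wpM2l l1') := ltW lt0.
rewrite -/(opt_transport (fun y => g (fcons b y)) x).
rewrite -/(opt_transport (fun y => g (fcons (~~ b) y)) x).
set a := opt_transport _ _; set c := opt_transport _ _.
set a' := transport_cost _ _ _; set c' := transport_cost _ _ _.
lra.
Qed.

(** This pointwise form of Hoelder's inequality becomes the usual one when A and
    B are the logarithms of the means of exp a and exp b. *)
Lemma expR_conj_le (R : realType) (l a b A B c : R) : 0 <= l <= 1 ->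
  expR ((1 - l) * a + l * b + c) <=
  expR ((1 - l) * A + l * B + c) *
    ((1 - l) * (expR (- A) * expR a) + l * (expR (- B) * expR b)).
Proof.
move=> l01; rewrite -2!expRD.
apply: le_trans (ler_wpM2l (expR_ge0 _) (expR_convex2 _ _ l01)).
by rewrite -expRD ler_expR le_eqVlt; apply/orP; left; apply/eqP; ring.
Qed.

(** Talagrand's convex distance inequality in transport form. Conditioning on
    the first coordinate, let H and - G be the logarithms of the conditional
    means of exp h and exp (- g). The induction hypothesis and Hoelder's
    inequality show that H and G satisfy the assumption of the case of one
    coordinate. *)
Theorem talagrand_transport (R : realType) (n : nat) (p : 'I_n -> R)
    (h g : {ffun 'I_n -> bool} -> R) :
  (forall i, 0 <= p i <= 1) ->
  (forall x w, is_distr w -> h x <= transport_cost g x w) ->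
  bmean p (fun x => expR (h x)) * bmean p (fun x => expR (- g x)) <= 1.
Proof.
elim: n p h g => [|n IH] p h g hp hg.
  have E f : bmean p f = f [ffun=> false].
    rewrite /bmean (big_pred1 [ffun=> false]) => [|x].
      by rewrite /bmass big_ord0 mul1r.
    by apply/esym/eqP/ffunP => -[].
  rewrite !E -expRD -expR0 ler_expR subr_le0.
  have := hg [ffun=> false] _ (distr_point R [ffun=> false]).
  rewrite /transport_cost big_ord0 mulr0 addr0 (big_pred1 [ffun=> false]) ?eqxx
    ?mul1r//.
  by move=> x; apply/esym/eqP/ffunP => -[].
rewrite !bmean_fcons !big_bool/=.
set p' := fun j => p (lift ord0 j).
have hp' i : 0 <= p' i <= 1 by exact: hp.
pose H b := ln (bmean p' (fun y => expR (h (fcons b y)))).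
pose G b := - ln (bmean p' (fun y => expR (- g (fcons b y)))).
have HE b : bmean p' (fun y => expR (h (fcons b y))) = expR (H b).
  by rewrite lnK// posrE bmean_gt0// => x; exact: expR_gt0.
have GE b : bmean p' (fun y => expR (- g (fcons b y))) = expR (- G b).
  by rewrite opprK lnK// posrE bmean_gt0// => x; exact: expR_gt0.
pose Q b := opt_transport (fun y => g (fcons b y)).
have QE b : expR (- G b) * bmean p' (fun y => expR (Q b y)) <= 1.
  have := IH p' (Q b) (fun y => g (fcons b y)) hp'.
  by move=> /(_ (fun x w dw => opt_transport_le _ x dw)); rewrite (GE b) mulrC.
have HG b l : 0 <= l <= 1 -> H b <= (1 - l) * G b + l * G (~~ b) +
  4^-1 * l ^+ 2.
  move=> l01; rewrite -ler_expR -(HE b).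
  set A := expR _.
  apply: (@le_trans _ _ (bmean p' (fun x => A *
    ((1 - l) * (expR (- G b) * expR (Q b x)) +
     l * (expR (- G (~~ b)) * expR (Q (~~ b) x)))))).
    apply: bmean_le => // x; apply: le_trans (expR_conj_le _ _ _ _ _ l01).
    by rewrite ler_expR; exact: (opt_transport_fcons l01 (hg _)).
  have A0 : 0 <= A by exact: expR_ge0.
  rewrite bmeanZ -[leRHS]mulr1 (ler_wpM2l A0)// bmeanD.
  rewrite (bmeanZ p' (1 - l)) (bmeanZ p' l) (bmeanZ p' (expR (- G b))).
  rewrite (bmeanZ p' (expR (- G (~~ b)))).
  have /andP[l0 l1] := l01; have l1' : 0 <= 1 - l by rewrite subr_ge0.
  apply: le_trans (lerD (ler_wpM2l l1' (QE b)) (ler_wpM2l l0 (QE (~~ b)))) _.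
  by rewrite !mulr1 subrK.
rewrite (HE true) (HE false) (GE true) (GE false).
have /andP[p0 p1] := hp ord0.
have q0 : 0 <= 1 - p ord0 by rewrite subr_ge0.
have HG0 b : H b <= G b.
  by have := HG b 0; rewrite lexx ler01 => /(_ isT);
    rewrite subr0 mul1r mul0r expr0n/= mulr0 !addr0.
have [le_G|/ltW le_G] := leP (G true) (G false).
  apply: (talagrand_two_point p0 q0 _ le_G (HG0 _)); first by ring.
  by move=> l l01; exact: (HG false).
rewrite [X in X * _]addrC [X in _ * X]addrC.
apply: (talagrand_two_point q0 p0 _ le_G (HG0 _)); first by ring.
by move=> l l01; exact: (HG true).
Qed.

(** * Lebesgue measure of Borel sets of row vectors *)

(** Row vectors with their Borel sets as measurable sets. *)
Notation borelT R d := (g_sigma_algebraType [set U : set 'rV[R]_d | open U]).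

(** Second countability: the balls with rational centres and radii 1 / (n + 1)
    form a basis of the topology. *)
Lemma open_bigcup_ball (R : realType) (d : nat) (U : set 'rV[R]_d) : open U ->
  U = \bigcup_(p : 'rV[rat]_d * nat)
        [set x | ball (map_mx ratr p.1 : 'rV[R]_d) p.2.+1%:R^-1 `<=` U /\
                 ball (map_mx ratr p.1 : 'rV[R]_d) p.2.+1%:R^-1 x].
Proof.
move=> oU; apply/seteqP; split => [x Ux|x [p _ [sub bx]]]; last exact: sub.
have /nbhs_ballP[e /= e0 sub] : nbhs x U by exact: open_nbhs_nbhs.
have [n ne] : exists n : nat, n.+1%:R^-1 < e / 2 :> R.
  exists (Num.truncn (e / 2)^-1); rewrite invf_plt ?posrE ?divr_gt0//.
  exact: truncnS_gt.
have n0 : 0 < n.+1%:R^-1 :> R by rewrite invr_gt0.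
have /choice[q hq] (j : 'I_d) : exists q : rat, `|x 0 j - ratr q| < n.+1%:R^-1.
  have /rat_in_itvoo[q] : x 0 j - n.+1%:R^-1 < x 0 j by rewrite ltrBlDr ltrDl.
  rewrite in_itv/= => /andP[h1 h2]; exists q.
  by rewrite ger0_norm ?subr_ge0 1?ltW// ltrBlDr addrC -ltrBlDr.
have bx : ball (map_mx ratr (\row_j q j) : 'rV[R]_d) n.+1%:R^-1 x.
  split => // i j; rewrite !mxE ord1 /ball/= distrC.
  exact: hq.
exists (\row_j q j, n) => //; split => // y /= by_.
apply: sub; apply: (@le_ball _ _ _ (n.+1%:R^-1 + n.+1%:R^-1)).
  by rewrite [leRHS]splitr lerD// ltW.
by apply: ball_triangle by_; apply: ball_sym.
Qed.

Lemma borel_measurable (R : realType) (d : nat) (A : set 'rV[R]_d) :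
  borel A = measurable (A : set (borelT R d)).
Proof. by []. Qed.

Lemma borel_measurable_fun (R : realType) (d : nat) (disp : measure_display)
    (T : measurableType disp) (f : T -> borelT R d) :
  (forall U : set 'rV[R]_d, open U -> measurable (f @^-1` U)) ->
  measurable_fun [set: T] f.
Proof.
move=> mf.
have := @measurability _ _ T (borelT R d) setT f [set U | open U] erefl.
by apply=> _ [U oU <-]; rewrite setTI; exact: mf.
Qed.

(** Only balls have to be pulled back. Balls for the sup norm are boxes, so that
    their preimages are measurable rectangles. *)
Lemma measurable_row_mx (R : realType) (d : nat) :
  measurable_fun setT
    (fun p : measurableTypeR R * borelT R d =>
       row_mx (const_mx p.1 : 'rV[R]_1) p.2 : borelT R (1 + d)).
Proof.
apply: borel_measurable_fun => U oU;
  rewrite (open_bigcup_ball oU) preimage_bigcup.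
apply: countable_bigcupT_measurable; first exact: countableP.
move=> [c n]; have [sub|nsub] :=
    pselect (ball (map_mx ratr c : 'rV[R]_(1 + d)) n.+1%:R^-1 `<=` U);
      last first.
  by rewrite (_ : _ @^-1` _ = set0)//; apply/seteqP; split => // x [].
rewrite (_ : _ @^-1` _ = ball (ratr (c 0 0) : R) n.+1%:R^-1 `*`
    ball (map_mx ratr (rsubmx c) : 'rV[R]_d) n.+1%:R^-1).
  apply: measurableX; first by rewrite ball_itv; exact: measurable_itv.
  by apply: sub_sigma_algebra => /=; apply: ball_open; rewrite invr_gt0.
apply/seteqP; split => [[x y] /= [_ [e0 b]]|[x y] /= [bx [e0 b]]].
  split => /=; first by have := b 0 0; rewrite !mxE split1 unlift_none /= mxE.
  split=> // i j; have := b i (rshift 1 j); rewrite !mxE ord1.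
  by case: split_ordP => [k /eqP|k /rshift_inj->]; rewrite ?eq_rlshift.
split => //; split => // i j; rewrite !mxE ord1.
case: split_ordP => k ->; rewrite ?mxE ?ord1.
  by rewrite (_ : lshift d 0 = 0)//; apply/val_inj.
by have := b 0 k; rewrite !mxE.
Qed.

Lemma closed_borel (R : realType) (d : nat) (A : set 'rV[R]_d) :
  closed A -> borel A.
Proof.
move=> cA; rewrite borel_measurable -[A]setCK; apply: measurableC.
by apply: sub_sigma_algebra; exact: closed_openC.
Qed.

(** The set whose volume is integrated in the recursive clause of [volume]. *)
Definition slice (R : realType) (d : nat) (x : R) (A : set 'rV[R]_d.+1) :
    set 'rV[R]_d :=
  [set y | A (row_mx (const_mx x : 'rV[R]_1) y : 'rV[R]_(1 + d))].

Lemma borelI (R : realType) (d : nat) (A B : set 'rV[R]_d) :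
  borel A -> borel B -> borel (A `&` B).
Proof. exact: (@measurableI _ (borelT R d)). Qed.

Lemma rV_norm_leP (R : realType) (d : nat) (x : 'rV[R]_d) (r : R) : 0 <= r ->
  reflect (forall j, `|x 0 j| <= r) (`|x| <= r).
Proof.
move=> r0; have -> : `|x| = \big[Num.max/0]_ij `|x ij.1 ij.2|
  by rewrite -mx_normrE.
apply: (iffP idP) => [/bigmax_leP[_ h] j|h]; first exact: (h (0, j)).
by apply/bigmax_leP; split => // -[i j] _; rewrite ord1; exact: h.
Qed.

Lemma box_borel (R : realType) (d : nat) (r : R) :
  borel [set x : 'rV[R]_d | `|x| <= r].
Proof.
apply: closed_borel.
apply: (@closed_comp _ _ (fun x : 'rV[R]_d => `|x|) [set y | y <= r]).
  by move=> x _; exact: norm_continuous.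
exact: closed_le.
Qed.

Lemma box_sigma_finite (R : realType) (d : nat)
    (mu : {measure set (borelT R d) -> \bar R}) :
  (forall r : R, (mu [set x : 'rV[R]_d | (`|x| <= r)%R] < +oo)%E) ->
  sigma_finite setT mu.
Proof.
move=> mu_fin; exists (fun n : nat => [set x : 'rV[R]_d | `|x| <= n%:R]).
  apply/esym/seteqP; split => // x _; exists (Num.truncn `|x|).+1 => //=.
  by rewrite ltW// truncnS_gt.
by move=> n; split; [exact: box_borel|exact: mu_fin].
Qed.

(** In the induction step the measure is the image under [row_mx] of the product
    of Lebesgue measure with the measure in dimension d. Finiteness on boxes is
    carried along because forming products requires sigma-finiteness. *)
Lemma volume_measure (R : realType) (d : nat) :
  exists mu : {sigma_finite_measure set (borelT R d) -> \bar R},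
    (forall A : set 'rV[R]_d, borel A -> volume A = mu A) /\
    (forall r : R, (mu [set x : 'rV[R]_d | (`|x| <= r)%R] < +oo)%E).
Proof.
elim: d => [|d [mu [volE mu_fin]]].
  exists (dirac (0 : borelT R 0) :
    {sigma_finite_measure set (borelT R 0) -> \bar R}).
  by split => [A bA //|r]; rewrite /= diracE ltry.
pose phi (p : measurableTypeR R * borelT R d) : borelT R (1 + d) :=
  row_mx (const_mx p.1 : 'rV[R]_1) p.2.
have mphi := @measurable_row_mx R d.
pose nu : {measure set (borelT R (1 + d)) -> \bar R} :=
  pushforward (@lebesgue_measure R \x mu)%E phi.
have volE' (A : set 'rV[R]_d.+1) : borel A -> volume A = nu mphi A.
  move=> bA; rewrite /= /nu /pushforward /product_measure1/=.
  apply: eq_integral => x _ /=.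
  have mA : measurable (phi @^-1` A) by rewrite -[X in measurable X]setTI;
    apply: mphi.
  have E : xsection (phi @^-1` A) x = slice x A.
    by apply/seteqP; split => y /=; rewrite /xsection/= inE.
  have bs : borel (slice x A).
    by rewrite borel_measurable -E; exact: measurable_xsection.
  by rewrite E -volE.
suff nu_fin (r : R) : (nu mphi [set x : 'rV[R]_d.+1 | (`|x| <= r)%R] < +oo)%E.
  have nu_sf := @box_sigma_finite R d.+1 _ nu_fin.
  exists (HB.pack_for (SigmaFiniteMeasure.type (borelT R d.+1) R)
    (Measure.sort (nu mphi))
    (isSFinite.Build _ _ _ _ (sfinite_measure_sigma_finite nu_sf))
    (isSigmaFinite.Build _ _ _ _ nu_sf)).
  by split.
have [r0|r0] := ltP r 0.
  have -> : [set x : 'rV[R]_d.+1 | (`|x| <= r)%R] = set0.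
    apply/seteqP; split=> // x /= xr.
    by have := le_lt_trans xr r0; rewrite normr_lt0.
  by rewrite measure0 ltry.
have mI : measurable `[- r, r]%classic by exact: measurable_itv.
have mB := @box_borel R d r.
apply: (@le_lt_trans _ _ ((@lebesgue_measure R \x mu)%E
    (`[- r, r]%classic `*` [set x : 'rV[R]_d | `|x| <= r]))).
  apply: (@le_measure _ _ _
      [the {measure set _ -> \bar R} of (@lebesgue_measure R \x mu)%E]).
  all: rewrite ?inE.
  - by rewrite -[X in measurable X]setTI;
    exact: (mphi measurableT _ (@box_borel R d.+1 r)).
  - exact: (@measurableX _ _ (measurableTypeR R) (borelT R d) _ _ mI mB).
  move=> [x y] /= /(rV_norm_leP _ r0) h0.
  have {h0}h (j : 'I_(1 + d)) :
    `|row_mx (const_mx x : 'rV[R]_1) (y : 'rV[R]_d) 0 j| <= r by exact: h0.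
  split => /=.
    rewrite in_itv/= -ler_norml; have := h (lshift d (0 : 'I_1)).
    by rewrite row_mxEl mxE.
  by apply/rV_norm_leP => // j; have := h (rshift 1 j); rewrite row_mxEr.
rewrite product_measure1E//; apply: lte_mul_pinfty => //.
by rewrite /= lebesgue_measure_itv/=; case: ifP.
Qed.

Definition vol (R : realType) (d : nat) :
  {sigma_finite_measure set (borelT R d) -> \bar R} :=
  projT1 (cid (volume_measure R d)).

Lemma volumeE (R : realType) (d : nat) (A : set 'rV[R]_d) :
  borel A -> volume A = vol R d A.
Proof. by rewrite /vol; case: cid => mu [h _] /=; exact: h. Qed.

Lemma volume_ge0 (R : realType) (d : nat) (A : set 'rV[R]_d) :
  borel A -> (0 <= volume A)%E.
Proof. by move=> bA; rewrite volumeE. Qed.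

Lemma volume_bounded (R : realType) (d : nat) (r : R) (A : set 'rV[R]_d) :
  borel A -> (forall x, A x -> `|x| <= r) -> (volume A < +oo)%E.
Proof.
move=> bA Ar; rewrite volumeE//.
have bB := @box_borel R d r.
apply: (@le_lt_trans _ _ (vol R d [set x | `|x| <= r])).
  by apply: le_measure; rewrite ?inE.
by rewrite /vol; case: cid => mu [_ h] /=; exact: h.
Qed.

Lemma slice_borel (R : realType) (d : nat) (x : R) (A : set 'rV[R]_d.+1) :
  borel A -> borel (slice x A).
Proof.
move=> bA; have mphi := @measurable_row_mx R d.
have mA := mphi measurableT _ bA.
rewrite setTI in mA.
have := @measurable_xsection _ _ (measurableTypeR R) (borelT R d) _ x mA.
rewrite (_ : xsection _ _ = slice x A)//.
by apply/seteqP; split => y /=; rewrite /xsection/= inE.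
Qed.

Lemma measurable_volume_slice (R : realType) (d : nat) (A : set 'rV[R]_d.+1) :
  borel A ->
  measurable_fun [set: R] (fun x : R => volume (slice x A)).
Proof.
move=> bA; have mphi := @measurable_row_mx R d.
have mA := mphi measurableT _ bA.
rewrite setTI in mA.
have := @measurable_fun_xsection _ _ (measurableTypeR R) (borelT R d) R
  (vol R d) _ mA.
apply: eq_measurable_fun => x _ /=; rewrite [RHS]volumeE;
  last exact: slice_borel.
by congr (vol R d _); apply/seteqP; split => y /=; rewrite /xsection/= inE.
Qed.

(** Lebesgue measure is c times its image under the affine map, because both
    measures agree on half-open intervals. *)
Lemma ge0_integral_affine (R : realType) (c b : R) (f : R -> \bar R) : 0 < c ->
  measurable_fun [set: R] f -> (forall x, 0 <= f x)%E ->
  (\int[@lebesgue_measure R]_x f (c * x + b)%R =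
   c^-1%:E * \int[@lebesgue_measure R]_x f x)%E.
Proof.
move=> c0 mf f0.
pose g (x : measurableTypeR R) : measurableTypeR R := c * x + b.
have mg : measurable_fun [set: measurableTypeR R] g.
  by apply: measurable_funD => //; exact: measurable_funM.
pose mu : {measure set (measurableTypeR R) -> \bar R} :=
  mscale (NngNum (ltW c0)) (pushforward (@lebesgue_measure R) g).
suff muE A : measurable A -> @lebesgue_measure R A = mu mg A.
  rewrite [in RHS](@eq_measure_integral _ _ _ _ (mu mg)); last first.
    by move=> A mA _; exact: muE.
  rewrite ge0_integral_mscale//= ge0_integral_pushforward//=.
  by rewrite muleA -EFinM mulVf ?gt_eqF// mul1e.
move=> mA; apply: lebesgue_measure_unique => // X /ocitvP[->|[[x y]/= xy ->]].
  by rewrite !measure0.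
rewrite /mu/= /mscale/= /pushforward.
have -> : g @^-1` `]x, y] = `](x - b) / c, (y - b) / c]%classic.
  apply/seteqP; split => z /=; rewrite !in_itv/= /g.
    by rewrite ltr_pdivrMr// ler_pdivlMr// ltrBlDr lerBrDr mulrC.
  by rewrite ltr_pdivrMr// ler_pdivlMr// ltrBlDr lerBrDr mulrC.
rewrite !lebesgue_measure_itv/= !lte_fin xy ltr_pM2r ?invr_gt0// ltrD2r xy.
rewrite -!EFinB -EFinM; congr (_%:E).
by rewrite -mulrBl mulrC divfK ?gt_eqF// opprB addrA subrK.
Qed.

Lemma volume_affine (R : realType) (d : nat) (c : R) (v : 'rV[R]_d)
    (A : set 'rV[R]_d) : 0 < c -> borel A ->
  volume [set x | A (c *: x + v)] = ((c ^- d)%:E * volume A)%E.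
Proof.
move=> c0; elim: d v A => [|d IH] v A bA.
  rewrite expr0 invr1 mul1e; congr (volume _); apply/funext => x /=.
  by congr A; apply/rowP => -[].
rewrite /= -/(volume).
pose v0 := lsubmx (v : 'rV[R]_(1 + d)) 0 0;
  pose v1 := rsubmx (v : 'rV[R]_(1 + d)).
have E x : volume (slice x [set x | A (c *: x + v)]) =
    ((c ^- d)%:E * volume (slice (c * x + v0) A))%E.
  rewrite -(IH v1); last exact: slice_borel.
  congr (volume _); rewrite /slice; apply/funext => y /=; congr A.
  have -> : row_mx (const_mx (c * x + v0) : 'rV[R]_1) (c *: y + v1) =
      c *: row_mx (const_mx x) y + (v : 'rV[R]_(1 + d)).
    rewrite -[in RHS](hsubmxK (v : 'rV[R]_(1 + d))) scale_row_mx add_row_mx.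
    by congr row_mx; apply/rowP => i; rewrite /v0 !mxE !ord1.
  by [].
transitivity (\int[@lebesgue_measure R]_x
    ((c ^- d)%:E * volume (slice (c * x + v0)%R A)))%E.
  by apply: eq_integral => x _; exact: E.
have mv := measurable_volume_slice bA.
have v_ge0 x : (0 <= volume (slice x A))%E.
  by rewrite volumeE; [exact: measure_ge0|exact: slice_borel].
rewrite ge0_integralZl//; last 2 first.
- apply: (measurableT_comp mv).
  by apply: measurable_funD => //; exact: measurable_funM.
- by rewrite lee_fin invr_ge0 exprn_ge0// ltW.
rewrite (ge0_integral_affine _ c0 mv)// muleA -EFinM; congr (_%:E * _)%E.
by rewrite -invfM -exprSr.
Qed.

(** * The Euclidean norm and its balls *)

Lemma sum_CauchySchwarz (R : realFieldType) (I : finType) (a b : I -> R) :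
  (\sum_i a i * b i) ^+ 2 <= (\sum_i a i ^+ 2) * (\sum_i b i ^+ 2).
Proof.
set A := \sum_i a i ^+ 2; set B := \sum_i b i ^+ 2; set C := \sum_i _ * _.
have A0 : 0 <= A by apply: sumr_ge0 => i _; exact: sqr_ge0.
have [A_gt0|A_le0] := ltP 0 A.
  rewrite -subr_ge0 -(pmulr_rge0 _ A_gt0).
  have -> : A * (A * B - C ^+ 2) = \sum_i (A * b i - C * a i) ^+ 2.
    transitivity (\sum_i (A ^+ 2 * b i ^+ 2 - (A * C) * 2 * (a i * b i) +
      C ^+ 2 * a i ^+ 2)).
      rewrite big_split/= sumrB -!mulr_sumr -/A -/B -/C; ring.
    by apply: eq_bigr => i _; ring.
  by apply: sumr_ge0 => i _; exact: sqr_ge0.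
have /eqP : A = 0 by apply/eqP; rewrite eq_le A_le0.
rewrite psumr_eq0 => [/allP a0|i _]; last exact: sqr_ge0.
rewrite /C big1 ?expr0n/= ?mulr_ge0//; last first.
  by move=> i _; have := a0 i (mem_index_enum i); rewrite sqrf_eq0 => /eqP ->;
    rewrite mul0r.
by apply: sumr_ge0 => i _; exact: sqr_ge0.
Qed.

Lemma enorm_ge0 (R : realType) (d : nat) (x : 'rV[R]_d) : 0 <= enorm x.
Proof. exact: sqrtr_ge0. Qed.

Lemma sqr_enorm (R : realType) (d : nat) (x : 'rV[R]_d) :
  enorm x ^+ 2 = \sum_(i < d) x 0 i ^+ 2.
Proof. by rewrite sqr_sqrtr// sumr_ge0// => i _; exact: sqr_ge0. Qed.

Lemma enormZ (R : realType) (d : nat) (c : R) (x : 'rV[R]_d) :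
  enorm (c *: x) = `|c| * enorm x.
Proof.
rewrite /enorm (eq_bigr (fun i => c ^+ 2 * x 0 i ^+ 2)); last first.
  by move=> i _; rewrite mxE exprMn.
by rewrite -mulr_sumr sqrtrM ?sqr_ge0// sqrtr_sqr.
Qed.

Lemma enormN (R : realType) (d : nat) (x : 'rV[R]_d) : enorm (- x) = enorm x.
Proof. by rewrite -scaleN1r enormZ normrN1 mul1r. Qed.

Lemma enormD (R : realType) (d : nat) (x y : 'rV[R]_d) :
  enorm (x + y) <= enorm x + enorm y.
Proof.
rewrite -(@ler_pXn2r _ 2)// ?nnegrE ?addr_ge0 ?enorm_ge0//.
rewrite sqrrD !sqr_enorm.
rewrite (eq_bigr (fun i => x 0 i ^+ 2 + (x 0 i * y 0 i) *+ 2 + y 0 i ^+ 2));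
  last first.
  by move=> i _; rewrite mxE sqrrD.
rewrite !big_split/= lerD2r lerD2l -mulr2n lerMn2r/=.
apply: le_trans (ler_norm _) _.
rewrite -(@ler_pXn2r _ 2)// ?nnegrE ?mulr_ge0 ?enorm_ge0//.
by rewrite real_normK ?num_real// exprMn !sqr_enorm sum_CauchySchwarz.
Qed.

Lemma enorm_dist (R : realType) (d : nat) (z x y : 'rV[R]_d) :
  enorm (x - y) <= enorm (x - z) + enorm (y - z).
Proof. by rewrite -(enormN (y - z)) opprB -[x - y](subrKA z) enormD. Qed.

Lemma enorm_eq0 (R : realType) (d : nat) (x : 'rV[R]_d) :
  (enorm x == 0) = (x == 0).
Proof.
apply/eqP/eqP => [e0|->]; last first.
  by rewrite /enorm big1 ?sqrtr0// => i _; rewrite mxE expr0n.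
have : \sum_(i < d) x 0 i ^+ 2 = 0 by rewrite -sqr_enorm e0 expr0n.
move/eqP; rewrite psumr_eq0 => [/allP a0|i _]; last exact: sqr_ge0.
apply/rowP => i; rewrite mxE; apply/eqP.
by rewrite -sqrf_eq0; exact: (a0 i (mem_index_enum i)).
Qed.

Lemma enorm_continuous (R : realType) (d : nat) :
  continuous (@enorm R d).
Proof.
have h : continuous (fun x : 'rV[R]_d => \sum_(i < d) x 0 i ^+ 2 : R).
  apply: continuous_big => [|i _ y]; first exact: add_continuous.
  apply: (@continuous_comp _ _ _ (fun x : 'rV[R]_d => x 0 i) (fun z : R =>
    z ^+ 2)).
    exact: coord_continuous.
  exact: exprn_continuous.
by move=> x; apply: continuous_comp; [exact: h|exact: sqrt_continuous].
Qed.

Lemma ler_dist_enorm (R : realType) (d : nat) (u v : 'rV[R]_d) :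
  `|enorm u - enorm v| <= enorm (u - v).
Proof.
have h (a b : 'rV[R]_d) : enorm a - enorm b <= enorm (a - b).
  by rewrite lerBlDr -{1}[a](subrK b) enormD.
rewrite ler_norml h andbT lerNl opprB -(enormN (u - v)) opprB; exact: h.
Qed.

Lemma enorm_sub_continuous (R : realType) (d : nat) (c : 'rV[R]_d) :
  continuous (fun x : 'rV[R]_d => enorm (x - c)).
Proof.
move=> x.
apply: (@continuous_comp _ _ _ (fun x : 'rV[R]_d => x - c) (@enorm R d)).
  apply: (@continuousB R 'rV[R]_d 'rV[R]_d id (fun=> c) x).
    exact: cvg_id.
  exact: cst_continuous.
exact: enorm_continuous.
Qed.

Lemma norm_le_enorm (R : realType) (d : nat) (x : 'rV[R]_d) : `|x| <= enorm x.
Proof.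
apply/rV_norm_leP; first exact: enorm_ge0.
move=> j; rewrite -(@ler_pXn2r _ 2)// ?nnegrE ?enorm_ge0// sqr_enorm.
rewrite (bigD1 j)//= real_normK ?num_real// lerDl.
by apply: sumr_ge0 => i _; exact: sqr_ge0.
Qed.

Lemma eball_borel (R : realType) (d : nat) (c : 'rV[R]_d) (r : R) :
  borel [set x | enorm (x - c) <= r].
Proof.
apply: closed_borel.
apply: (@closed_comp _ _ (fun x : 'rV[R]_d => enorm (x - c)) [set y | y <= r]).
  by move=> x _; exact: enorm_sub_continuous.
exact: closed_le.
Qed.

Lemma eball_bounded (R : realType) (d : nat) (c : 'rV[R]_d) (r : R) :
  exists M : R, forall x, enorm (x - c) <= r -> `|x| <= M.
Proof.
exists (r + `|c|) => x xr; rewrite -[x](subrK c).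
by apply: le_trans (ler_normD _ _) _;
  rewrite lerD2r (le_trans (norm_le_enorm _)).
Qed.

Lemma volume_eball_fin (R : realType) (d : nat) (c : 'rV[R]_d) (r : R) :
  (volume [set x | (enorm (x - c) <= r)%R] < +oo)%E.
Proof.
have [M hM] := eball_bounded c r.
by apply: (@volume_bounded _ _ M); first exact: eball_borel.
Qed.

Lemma volume_eball (R : realType) (d : nat) (c : 'rV[R]_d) (r : R) : 0 < r ->
  volume [set x | enorm (x - c) <= r] = (kappa R d * r ^+ d)%:E.
Proof.
move=> r0; have E : [set x : 'rV[R]_d | enorm x <= 1] =
  [set x : 'rV[R]_d | enorm (x - 0) <= 1].
  by apply/funext => x /=; rewrite subr0.
have r'0 : 0 < r^-1 by rewrite invr_gt0.
have -> : [set x | enorm (x - c) <= r] =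
    [set x : 'rV[R]_d | [set x : 'rV[R]_d | enorm x <= 1] (r^-1 *: x +
      (- r^-1 *: c))].
  apply/funext => x /=; rewrite scaleNr -scalerBr enormZ gtr0_norm//.
  by rewrite mulrC ler_pdivrMr// mul1r.
rewrite volume_affine//; last by rewrite E; exact: eball_borel.
rewrite /kappa mulrC EFinM fineK; last first.
  rewrite ge0_fin_numE; first by rewrite E volume_eball_fin.
  by rewrite E volumeE; [exact: measure_ge0|exact: eball_borel].
by rewrite exprVn invrK.
Qed.

(** If the unit ball were negligible, so would be all balls, and with them the
    bounded set W. *)
Lemma kappa_gt0 (R : realType) (d : nat) (W : set 'rV[R]_d) (M : R) :
  borel W -> (forall x, W x -> `|x| <= M) -> (0 < volume W)%E -> 0 < kappa R d.
Proof.
move=> bW WM W0; pose r := d%:R * M ^+ 2 + 1.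
have r0 : 0 < r by rewrite ltr_wpDl// mulr_ge0// sqr_ge0.
have : (0 < volume [set x : 'rV[R]_d | (enorm (x - 0) <= r)%R])%E.
  apply: (lt_le_trans W0); rewrite !volumeE//; last exact: eball_borel.
  apply: le_measure; rewrite ?inE; [exact: bW|exact: eball_borel|].
  move=> x /WM xM /=; rewrite subr0 -(@ler_pXn2r _ 2)// ?nnegrE ?enorm_ge0
    ?(ltW r0)//.
  rewrite sqr_enorm; apply: (@le_trans _ _ (d%:R * M ^+ 2)).
    rewrite -[d in d%:R]card_ord mulr_natl -sumr_const; apply: ler_sum => i _.
    have M0 : 0 <= M by exact: le_trans xM.
    move/(rV_norm_leP _ M0)/(_ i) : xM => xM.
    by rewrite -real_normK ?num_real// ler_pXn2r ?nnegrE.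
  have : 0 <= d%:R * M ^+ 2 by rewrite mulr_ge0// sqr_ge0.
  rewrite /r; nra.
by rewrite volume_eball// lte_fin pmulr_lgt0// exprn_gt0.
Qed.

(** * Weighted graphs on a random vertex set *)

Section occupied_graph.
Context (R : realType) (n : nat) (h : 'I_n -> 'I_n -> R).
Hypothesis h_sym : forall i j, h i j = h j i.
Hypothesis h_ge0 : forall i j, 0 <= h i j.
Implicit Types x y : {ffun 'I_n -> bool}.

Definition vertex_weight x i : R :=
  (x i)%:R * \sum_(j | j != i) (x j)%:R * h i j.

Definition total_weight x : R := 2^-1 * \sum_i vertex_weight x i.

Lemma vertex_weight_ge0 x i : 0 <= vertex_weight x i.
Proof. by rewrite mulr_ge0// sumr_ge0// => j _; rewrite mulr_ge0. Qed.

(** An edge of x that is lost in y has an endpoint outside y; it is charged to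
    each such endpoint. *)
Lemma total_weight_sub x y :
  total_weight x - total_weight y <= \sum_i vertex_weight x i * (y i != x i)%:R.
Proof.
pose e (z : {ffun 'I_n -> bool}) i j : R := (z i)%:R * ((z j)%:R * h i j).
have E z i : vertex_weight z i = \sum_(j | j != i) e z i j
  by rewrite /vertex_weight mulr_sumr.
pose d i : R := (y i != x i)%:R.
have le_e i j : e x i j - e y i j <= e x i j * d i + e x i j * d j.
  rewrite /e /d; have := h_ge0 i j.
  by case: (x i); case: (x j); case: (y i); case: (y j) => /=;
    rewrite ?mul1r ?mul0r ?mulr1 ?mulr0 ?mul1r; lra.
have sw : \sum_i \sum_(j | j != i) e x i j * d j =
  \sum_i vertex_weight x i * d i.
  rewrite (exchange_big_dep xpredT)//=; apply: eq_bigr => j _.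
  rewrite E mulr_suml; apply: eq_big => [i|i _]; first by rewrite eq_sym.
  by rewrite /e h_sym; congr (_ * _); ring.
have sw' : \sum_i \sum_(j | j != i) e x i j * d i =
  \sum_i vertex_weight x i * d i.
  by apply: eq_bigr => i _; rewrite E mulr_suml.
have : \sum_i \sum_(j | j != i) (e x i j - e y i j) <=
    \sum_i \sum_(j | j != i) (e x i j * d i + e x i j * d j).
  by apply: ler_sum => i _; apply: ler_sum => j _; exact: le_e.
under eq_bigr do rewrite sumrB -!E.
under [X in _ <= X]eq_bigr do rewrite big_split/=.
rewrite sumrB big_split/= sw sw' /total_weight -/(d _); lra.
Qed.

(** [talagrand_transport] is applied to c times the indicator of the set of the
    second factor and to 2 * c times the indicator of the complement of the set
    of the first one, where - c is the exponent; 2 * c is a large enough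
    substitute for infinity. For a law w giving mass th to the first set, the
    Cauchy-Schwarz inequality bounds the squared transport vector from below by
    4 * c * th ^ 2, so that the cost is at least 2 * c * (1 - th) + c * th ^ 2
    >= c. *)
Lemma occupied_graph_talagrand (p : 'I_n -> R) (a b K : R) :
  (forall i, 0 <= p i <= 1) -> 0 <= a -> a < b -> 0 < K ->
  bmean p (fun x => (total_weight x <= a)%R%:R) *
  bmean p (fun x => ((b <= total_weight x) && [forall i, vertex_weight x i <=
    K])%:R) <=
  expR (- ((b - a) ^+ 2 / (8 * K * b))).
Proof.
move=> hp a0 ab K0; set c := _ / _; have b0 : 0 < b by exact: le_lt_trans ab.
pose bad x := (b <= total_weight x) && [forall i, vertex_weight x i <= K].
have c0 : 0 <= c by rewrite divr_ge0 ?sqr_ge0// !mulr_ge0 ?ltW.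
pose f x : R := c * (bad x)%:R.
pose g x : R := 2 * c * (a < total_weight x)%R%:R.
have fg x w : is_distr w -> f x <= transport_cost g x w.
  move=> [w0 w1].
  set S := \sum_i (\sum_(y : {ffun 'I_n -> bool} | y i != x i) w y) ^+ 2.
  have S0 : 0 <= S by apply: sumr_ge0 => i _; exact: sqr_ge0.
  pose th := \sum_(y | total_weight y <= a) w y.
  have gE : \sum_y w y * g y = 2 * c * (1 - th).
    have -> : 1 - th = \sum_(y | ~~ (total_weight y <= a)) w y.
      by rewrite -w1 (bigID (fun y => total_weight y <= a))/= -/th addrAC subrr
        add0r.
    rewrite (bigID (fun y => total_weight y <= a))/= big1 ?add0r => [|y ya].
      by rewrite mulr_sumr; apply: eq_bigr => y; rewrite -ltNge /g => ->;
        rewrite mulr1 mulrC.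
    by rewrite /g ltNge ya !mulr0.
  rewrite /transport_cost gE -/S.
  have th0 : 0 <= th by exact: sumr_ge0.
  have th1 : th <= 1 by rewrite -w1 /th
    [leRHS](bigID (fun y => total_weight y <= a))/= lerDl sumr_ge0.
  rewrite /f; case: (boolP (bad x)) => [|_]; last first.
    have t0 : 0 <= 1 - th by rewrite subr_ge0.
    by rewrite mulr0 addr_ge0// mulr_ge0// mulr_ge0.
  move=> /andP[bx /forallP Kx]; rewrite mulr1.
  set T := total_weight x in bx *.
  have T0 : 0 < T by exact: lt_le_trans bx.
  have lin : (T - a) * th <= \sum_i vertex_weight x i *
      (\sum_(y : {ffun 'I_n -> bool} | y i != x i) w y).
    have -> : \sum_i vertex_weight x i *
      (\sum_(y : {ffun 'I_n -> bool} | y i != x i) w y) =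
        \sum_y w y * \sum_i vertex_weight x i * (y i != x i)%:R.
      under eq_bigr => i _ do rewrite mulr_sumr big_mkcond.
      rewrite exchange_big/=; apply: eq_bigr => y _; rewrite mulr_sumr.
      by apply: eq_bigr => i _; case: (y i != x i);
        rewrite ?mulr1 ?mulr0 1?mulrC.
    rewrite [leRHS](bigID (fun y => total_weight y <= a))/= -[leLHS]addr0.
    apply: lerD; last first.
      apply: sumr_ge0 => y _; rewrite mulr_ge0// sumr_ge0// => i _.
      by rewrite mulr_ge0// vertex_weight_ge0.
    rewrite /th mulr_sumr; apply: ler_sum => y ya; rewrite mulrC ler_wpM2l//.
    by apply: le_trans (total_weight_sub _ _); rewrite lerD2l lerN2.
  have sq_weights : \sum_i vertex_weight x i ^+ 2 <= 2 * K * T.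
    have -> : 2 * K * T = \sum_i K * vertex_weight x i.
      by rewrite -mulr_sumr /T /total_weight; field.
    by apply: ler_sum => i _; rewrite expr2 ler_wpM2r ?vertex_weight_ge0.
  have CS := sum_CauchySchwarz (vertex_weight x)
    (fun i => \sum_(y : {ffun 'I_n -> bool} | y i != x i) w y).
  have Tath : 0 <= (T - a) * th.
    by rewrite mulr_ge0// subr_ge0 (le_trans (ltW ab)).
  have S1 : ((T - a) * th) ^+ 2 <= 2 * K * T * S.
    apply: le_trans (le_trans CS _); last by rewrite ler_wpM2r.
    by rewrite ler_pXn2r// nnegrE// (le_trans Tath).
  (* (T - a) ^ 2 / T increases for T >= b > a >= 0. *)
  have ratio : (b - a) ^+ 2 * T <= (T - a) ^+ 2 * b.
    rewrite -subr_ge0.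
    have -> : (T - a) ^+ 2 * b - (b - a) ^+ 2 * T = (T - b) * (T * b - a * a)
      by ring.
    apply: mulr_ge0; first by rewrite subr_ge0.
    by rewrite subr_ge0; apply: ler_pM => //; lra.
  have cE : (b - a) ^+ 2 = c * (8 * K * b).
    by rewrite /c divfK// gt_eqF// !mulr_gt0.
  have S2 : c * th ^+ 2 <= 4^-1 * S.
    have h1 : (b - a) ^+ 2 * T * th ^+ 2 <= (T - a) ^+ 2 * b * th ^+ 2.
      by rewrite ler_wpM2r ?sqr_ge0.
    have h2 : ((T - a) * th) ^+ 2 * b <= 2 * K * T * S * b.
      by rewrite ler_wpM2r // ltW.
    have h3 : (K * T * b) * (8 * (c * th ^+ 2)) <= (K * T * b) * (2 * S).
      move: h1 h2; rewrite cE; lra.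
    by move: h3; rewrite ler_pM2l ?(mulr_gt0 (mulr_gt0 K0 T0) b0)//; lra.
  have := mulr_ge0 c0 (sqr_ge0 (1 - th)); lra.
have := talagrand_transport hp fg.
set X := bmean p (fun x => expR (f x));
  set Y := bmean p (fun x => expR (- g x)).
move=> XY.
have hX : expR c * bmean p (fun x => (bad x)%:R) <= X.
  rewrite -bmeanZ; apply: bmean_le => // x; rewrite /f.
  by case: (bad x); rewrite ?mulr1 ?mulr0 ?expR_ge0.
have hY : bmean p (fun x => (total_weight x <= a)%R%:R) <= Y.
  apply: bmean_le => // x; rewrite /g ltNge.
  by case: (total_weight x <= a) => /=; rewrite ?mulr0 ?oppr0 ?expR0 ?expR_ge0.
have pos (P : pred {ffun 'I_n -> bool}) : 0 <= bmean p (fun x => (P x)%:R).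
  by apply: sumr_ge0 => x _; rewrite mulr_ge0 ?bmass_ge0.
have := ler_pM (mulr_ge0 (expR_ge0 c) (pos bad)) (pos _) hX hY.
move=> /le_trans /(_ XY);
  rewrite -mulrA mulrC expRN -[_^-1]mul1r ler_pdivlMr ?expR_gt0//.
by rewrite [X in X * expR c <= _]mulrC.
Qed.

(** A union bound over the vertex i, and Markov's inequality for the exponential
    of s times the degree of i. The event that i is occupied contributes the
    factor p i, independent of its neighbours since a vertex is not its own
    neighbour. *)
Lemma bernoulli_degree_tail (p : 'I_n -> R) (adj : 'I_n -> 'I_n -> bool)
  (s B Lam : R) :
  (forall i, 0 <= p i <= 1) -> 0 <= s ->
  (forall i, \sum_(j | adj i j) p j <= Lam) ->
  bmean p (fun x => [exists i,
    x i && (B <= \sum_(j | j != i) (x j && adj i j)%:R)]%:R) <=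
  (\sum_i p i) * (expR (- (s * B)) * expR ((expR s - 1) * Lam)).
Proof.
move=> hp s0 hLam.
pose phi i k (c : bool) : R :=
  if k == i then c%:R else expR (s * (c && adj i k)%:R).
have phi_ge0 i k c : 0 <= phi i k c by rewrite /phi; case: ifP => _;
  rewrite ?expR_ge0.
apply: (@le_trans _ _ (bmean p (fun x =>
  \sum_i expR (- (s * B)) * \prod_k phi i k (x k)))).
  apply: bmean_le => // x; case: existsP => /= [[i /andP[xi Bi]]|_]; last first.
    by apply: sumr_ge0 => i _; rewrite mulr_ge0 ?expR_ge0// prodr_ge0.
  rewrite (bigD1 i)//= -[leLHS]addr0; apply: lerD; last first.
    by apply: sumr_ge0 => k _; rewrite mulr_ge0 ?expR_ge0// prodr_ge0.
  rewrite (bigD1 i)//= {1}/phi eqxx xi mul1r.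
  rewrite (eq_bigr (fun k => expR (s * (x k && adj i k)%:R))); last first.
    by move=> k /negbTE ki; rewrite /phi ki.
  rewrite -expR_sum -expRD -mulr_sumr.
  apply: le_trans (expR_ge1Dx _); rewrite lerDl addrC subr_ge0.
  by rewrite ler_wpM2l.
rewrite /bmean; under eq_bigr do rewrite mulr_sumr.
rewrite exchange_big/= mulr_suml; apply: ler_sum => i _.
have -> : \sum_x bmass p x * (expR (- (s * B)) * \prod_k phi i k (x k)) =
    expR (- (s * B)) * bmean p (fun x => \prod_k phi i k (x k)).
  by rewrite -bmeanZ.
rewrite bmean_prod (bigD1 i)//= {1 2}/phi eqxx mulr0 add0r mulr1.
rewrite mulrCA; apply: ler_wpM2l; first by have /andP[] := hp i.
apply: ler_wpM2l; first exact: expR_ge0.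
apply: (@le_trans _ _ (\prod_(k | k != i) expR
  ((expR s - 1) * (if adj i k then p k else 0)))).
  apply: ler_prod => k /negbTE ki; have /andP[p0 p1] := hp k.
  have hm : 0 <= 1 - p k by rewrite subr_ge0.
  rewrite addr_ge0 ?mulr_ge0//=.
  rewrite /phi ki /= mulr0 expR0 mulr1.
  apply: le_trans (expR_ge1Dx _); case: (adj i k);
    rewrite /= ?mulr1 ?mulr0 ?expR0; lra.
rewrite -expR_sum ler_expR -mulr_sumr; apply: ler_wpM2l.
  by rewrite subr_ge0 -expR0 ler_expR.
apply: le_trans (hLam i); rewrite [leRHS]big_mkcond [leRHS](bigD1 i)//= lerDr.
by case: ifP => // _; have /andP[] := hp i.
Qed.

Lemma bernoulli_graph_tail (p : 'I_n -> R) (adj : 'I_n -> 'I_n -> bool)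
    (H s B Lam M a b : R) :
  (forall i, 0 <= p i <= 1) -> 0 <= s -> 0 < H -> 0 < B -> 0 <= a -> a < b ->
  (forall i j, h i j <= H * (adj i j)%:R) ->
  (forall i, \sum_(j | adj i j) p j <= Lam) -> \sum_i p i <= M ->
  bmean p (fun x => (total_weight x <= a)%R%:R) *
  (bmean p (fun x => (b <= total_weight x)%R%:R) -
     M * (expR (- (s * B)) * expR ((expR s - 1) * Lam))) <=
  expR (- ((b - a) ^+ 2 / (8 * (H * B) * b))).
Proof.
move=> hp s0 H0 B0 a0 ab hH hLam hM.
apply: le_trans (occupied_graph_talagrand hp a0 ab (mulr_gt0 H0 B0)).
apply: ler_wpM2l; first by apply: sumr_ge0 => x _; rewrite mulr_ge0 ?bmass_ge0.
rewrite lerBlDr; apply: (@le_trans _ _ (bmean p (fun x =>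
  ((b <= total_weight x) && [forall i, vertex_weight x i <= H * B])%:R +
  [exists i, x i && (B <= \sum_(j | j != i) (x j && adj i j)%:R)]%:R)));
    last first.
  rewrite bmeanD lerD2l (le_trans (bernoulli_degree_tail _ hp s0 hLam))//.
  by rewrite ler_wpM2r// mulr_ge0 ?expR_ge0.
apply: bmean_le => // x; case: (b <= _) => /=; last by rewrite add0r.
case: existsP => [_|Nex]; first by rewrite lerDr.
rewrite addr0; case: forallP => // /= abs; exfalso; apply: abs => i.
rewrite /vertex_weight; case: (boolP (x i)) => [xi|_]; last first.
  by rewrite mul0r mulr_ge0 ?ltW.
rewrite mul1r; apply: (@le_trans _ _
  (H * \sum_(j | j != i) (x j && adj i j)%:R)).
  rewrite mulr_sumr; apply: ler_sum => j _.
  by case: (x j) => /=; rewrite ?mul1r ?mul0r ?mulr0.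
rewrite ler_pM2l// leNgt; apply/negP => /ltW lt; apply: Nex.
by exists i; rewrite xi.
Qed.

End occupied_graph.

(** * Cutting the domain into cells *)

(** A finite cover by balls of radius e, made disjoint by removing from each
    ball the preceding ones. *)
Lemma compact_cells (R : realType) (d : nat) (W : set 'rV[R]_d) (e : R) :
  compact W -> 0 < e ->
  exists n (c : 'I_n -> 'rV[R]_d) (C : 'I_n -> set 'rV[R]_d),
    [/\ forall i, borel (C i), trivIset [set: 'I_n] C,
        forall x, W x -> exists i, C i x &
        forall i x, C i x -> enorm (x - c i) < e].
Proof.
move=> cW e0.
have oB (c : 'rV[R]_d) : open [set x | enorm (x - c) < e].
  have -> : [set x | enorm (x - c) < e] =
      (fun x : 'rV[R]_d => enorm (x - c)) @^-1` [set r | r < e] by [].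
  apply: open_comp; last exact: open_lt.
  by move=> x _; exact: enorm_sub_continuous.
move: cW; rewrite compact_cover =>
  /(_ _ W (fun c => [set x | enorm (x - c) < e])).
case=> [c _|x Wx|D _ WD]; first exact: oB.
  by exists x => //=; rewrite subrr (_ : enorm 0 = 0) //; apply/eqP;
    rewrite enorm_eq0.
pose B k : set 'rV[R]_d :=
  if (k < #|` D|)%N then [set x | enorm (x - nth 0 D k) < e] else set0.
exists #|` D|, (fun i => nth 0 D i), (fun i => seqDU B i); split.
- move=> i; have bB k : borel (B k).
    rewrite /B; case: ifP => _; rewrite borel_measurable;
      last exact: measurable0.
    by apply: sub_sigma_algebra; exact: oB.
  rewrite borel_measurable /seqDU; apply: measurableD; first exact: bB.
  by apply: bigsetU_measurable => k _; exact: bB.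
- move=> i j _ _ h; apply/val_inj;
  exact: (@trivIset_seqDU _ B _ _ Logic.I Logic.I h).
- move=> x /WD [c /= cD xc].
  have : (\bigcup_k B k) x.
    exists (index c D) => //; rewrite /B index_mem cD /=.
    by rewrite nth_index.
  rewrite seqDU_bigcup_eq => -[k _ h].
  have kD : (k < #|` D|)%N by move: h => -[]; rewrite /B; case: ifP.
  by exists (Ordinal kD).
- by move=> i x []; rewrite /B ltn_ord.
Qed.

Section occupation.
Context (R : realType) (d : nat) (disp : measure_display)
  (T : measurableType disp) (P : probability T R)
  (W : set 'rV[R]_d) (t : R) (eta : T -> {fset 'rV[R]_d}).
Hypothesis eta_poisson : poisson_process P W t eta.
Hypothesis t_gt0 : 0 < t.
Context (n : nat) (C : 'I_n -> set 'rV[R]_d).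
Hypothesis C_borel : forall i, borel (C i).
Hypothesis C_disj : trivIset [set: 'I_n] C.

Definition occupied (w : T) : {ffun 'I_n -> bool} :=
  [ffun i => (0 < npoints (eta w) (C i))%N].

Definition cell_prob (i : 'I_n) : R :=
  1 - expR (- (t * fine (volume (C i `&` W)))).

Lemma measurable_occupied1 i b :
  measurable [set w | (0 < npoints (eta w) (C i))%N = b].
Proof.
have := pp_measurable eta_poisson (C_borel i) measurableT (Y :=
  [set k | (0 < k)%N = b]).
by rewrite setTI; apply.
Qed.

Lemma prob_occupied1 (i : 'I_n) b : borel W ->
  P [set w | (0 < npoints (eta w) (C i))%N = b] = (bern (cell_prob i) b)%:E.
Proof.
move=> bW; pose r := fine (volume (C i `&` W)).
have r0 : 0 <= t * r.
  rewrite mulr_ge0 ?(ltW t_gt0)// fine_ge0// volume_ge0//.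
  exact: borelI.
have P0 : P [set w | (0 < npoints (eta w) (C i))%N = false] =
  (expR (- (t * r)))%:E.
  have -> := pp_poisson eta_poisson (C_borel i) [set k | (0 < k)%N = false].
  rewrite -/r /poisson_prob; have [r_gt0|r_le0] := ltP 0 (t * r).
    have -> : [set k | (0 < k)%N = false] = [set 0%N].
      by apply/seteqP; split => [[]|_ ->].
    by rewrite esum_set1 /poisson_pmf r_gt0 ?expr0 ?fact0 ?divr1 ?mul1r//
      lee_fin expR_ge0.
  by rewrite diracE mem_set//= (_ : t * r = 0) ?oppr0 ?expR0//; apply/eqP;
    rewrite eq_le r_le0.
case: b; rewrite /bern /cell_prob -/r; last by rewrite subKr.
rewrite EFinB -P0 -probability_setC; last exact: measurable_occupied1.
by congr (P _); apply/seteqP; split => w /=; case: (0 < _)%N.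
Qed.

Lemma measurable_occupied (Phi : pred {ffun 'I_n -> bool}) :
  measurable [set w | Phi (occupied w)].
Proof.
have -> : [set w | Phi (occupied w)] =
    \bigcup_(x in [set x | Phi x]) \bigcap_(i in [set: 'I_n])
      [set w | (0 < npoints (eta w) (C i))%N = x i].
  apply/seteqP; split => [w h|w [x Px h]] /=.
    by exists (occupied w) => // i _ /=; rewrite ffunE.
  by rewrite (_ : occupied w = x)//; apply/ffunP => i; rewrite ffunE; exact: h.
apply: fin_bigcup_measurable; first exact: finite_finset.
move=> x _; apply: fin_bigcap_measurable; first exact: finite_finset.
by move=> i _; exact: measurable_occupied1.
Qed.

Lemma prob_occupied (Phi : pred {ffun 'I_n -> bool}) : borel W ->
  P [set w | Phi (occupied w)] = (bmean cell_prob (fun x => (Phi x)%:R))%:E.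
Proof.
move=> bW; have P1 x : P [set w | occupied w = x] = (bmass cell_prob x)%:E.
  have -> : [set w | occupied w = x] =
      [set w | forall i, [set k | (0 < k)%N = x i] (npoints (eta w) (C i))].
    apply/seteqP; split => [w <- i /=|w h /=]; first by rewrite ffunE.
    by apply/ffunP => i; rewrite ffunE; exact: h.
  rewrite (pp_independent eta_poisson C_borel C_disj (fun i =>
    [set k | (0 < k)%N = x i])).
  rewrite /bmass -prodEFin.
  by apply: eq_bigr => i _; exact: prob_occupied1.
have Ps (s : seq {ffun 'I_n -> bool}) : uniq s ->
    P [set w | occupied w \in s] = (\sum_(x <- s) bmass cell_prob x)%:E.
  elim: s => [_|x s IH /= /andP[xs us]].
    by rewrite big_nil (_ : [set w | _] = set0) ?measure0//; apply/seteqP;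
      split.
  rewrite big_cons EFinD -IH// -P1 -measureU.
  - congr (P _); apply/seteqP; split => w /=; rewrite inE.
      by case/orP => [/eqP|]; [left|right].
    by case=> [->|->]; rewrite ?eqxx ?orbT.
  - rewrite (_ : [set w | _] = [set w | pred1 x (occupied w)]).
      exact: measurable_occupied.
    by apply/seteqP; split => w /= /eqP.
  - exact: (measurable_occupied (mem s)).
  - by apply/seteqP; split => // w [/= ->]; rewrite (negbTE xs).
have -> : bmean cell_prob (fun x => (Phi x)%:R) =
  \sum_(x <- enum Phi) bmass cell_prob x.
  rewrite big_enum/= [RHS]big_mkcond /bmean; apply: eq_bigr => x _.
  by rewrite unfold_in; case: (Phi x); rewrite ?mulr1 ?mulr0.
rewrite -(Ps _ (enum_uniq Phi)); congr (P _).
by apply/seteqP; split => w /=; rewrite mem_enum.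
Qed.

Hypothesis W_borel : borel W.

Lemma cell_mean_ge0 i : 0 <= t * fine (volume (C i `&` W)).
Proof. by rewrite mulr_ge0 ?(ltW t_gt0)// fine_ge0// volume_ge0//;
  exact: borelI. Qed.

Lemma cell_prob01 i : 0 <= cell_prob i <= 1.
Proof.
rewrite /cell_prob; apply/andP; split; last by rewrite lerBlDr lerDl expR_ge0.
by rewrite subr_ge0 expR_le1 oppr_le0 cell_mean_ge0.
Qed.

Lemma cell_prob_le i : cell_prob i <= t * fine (volume (C i `&` W)).
Proof. by rewrite lerBlDr addrC -lerBlDr; exact: expR_ge1Dx. Qed.

(** 1 - exp (- r) <= r, and the cells are disjoint. *)
Lemma sum_cell_prob_le (Q : pred 'I_n) (S : set 'rV[R]_d) :
  borel S -> (volume S < +oo)%E -> (forall i, Q i -> C i `&` W `<=` S) ->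
  \sum_(i | Q i) cell_prob i <= t * fine (volume S).
Proof.
move=> bS S_fin CS.
have fin (A : set 'rV[R]_d) : borel A -> A `<=` S -> volume A \is a fin_num.
  move=> bA AS; rewrite ge0_fin_numE ?volume_ge0//; apply: le_lt_trans S_fin.
  by rewrite !volumeE//; apply: le_measure; rewrite ?inE.
apply: (@le_trans _ _ (\sum_(i | Q i) t * fine (volume (C i `&` W)))).
  by apply: ler_sum => i _; exact: cell_prob_le.
rewrite -mulr_sumr ler_pM2l// -lee_fin fineK; last exact: fin.
rewrite -sumEFin (eq_bigr (fun i => vol R d (C i `&` W))); last first.
  move=> i Qi; rewrite fineK; first by rewrite volumeE//; exact: borelI.
  by apply: fin; [exact: borelI|exact: CS].
rewrite -measure_bigsetU_ord_cond.
- rewrite volumeE//; apply: le_measure; rewrite ?inE.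
  + by apply: bigsetU_measurable => i _; exact: borelI.
  + exact: bS.
  + apply: (big_ind (fun A => A `<=` S)) => [//|A B AS BS x [/AS|/BS]//|i Qi].
    exact: CS.
- by move=> i _; exact: borelI.
- apply: (@sub_trivIset _ _ (fun x => Q x) setT) => //; exact: trivIset_setIr.
Qed.

End occupation.

Section cell_weights.
Context (R : realType) (d n : nat) (C : 'I_n -> set 'rV[R]_d)
  (h : 'I_n -> 'I_n -> R).
Hypothesis C_disj : trivIset [set: 'I_n] C.

Lemma cell_unique i j x : C i x -> C j x -> i = j.
Proof. by move=> Cix Cjx; apply: C_disj => //; exists x. Qed.

Lemma occupied_indicator (X : {fset 'rV[R]_d}) (A : set 'rV[R]_d) :
  {in X &, forall x y, A x -> A y -> x = y} ->
  (0 < npoints X A)%N%:R = \sum_(x <- X) (x \in A)%:R :> R.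
Proof.
move=> A1; rewrite /npoints cardfs_gt0.
have [[x xX Ax]|noA] := pselect (exists2 x, x \in X & A x).
  have -> : [fset x in X | x \in A]%fset != fset0.
    by apply/fset0Pn; exists x; rewrite !inE /= xX mem_set.
  rewrite (bigD1_seq x)//= mem_set// big_seq_cond big1 ?addr0// =>
    y /andP[yX yx].
  by case: (boolP (y \in A)) => // /set_mem Ay;
    rewrite (A1 _ _ yX xX Ay Ax) eqxx in yx.
rewrite big_seq big1 => [|y yX].
  have -> // : [fset x in X | x \in A]%fset == fset0.
  apply/fset0Pn => -[y]; rewrite !inE/= => /andP[yX /set_mem Ay].
  by apply: noA; exists y.
by case: (boolP (y \in A)) => // /set_mem Ay; exfalso; apply: noA; exists y.
Qed.

(** The weight of the edge between the cells of x and y, written as a sum over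
    all cells so that no function choosing the cell of a point is needed. *)
Definition pair_weight (x y : 'rV[R]_d) : R :=
  \sum_i \sum_(j | j != i) (x \in C i)%:R * ((y \in C j)%:R * h i j).

Lemma pair_weightE x y i j : C i x -> C j y ->
  pair_weight x y = (j != i)%:R * h i j.
Proof.
move=> Cx Cy; rewrite /pair_weight (bigD1 i)//= [X in _ + X]big1 ?addr0;
  last first.
  move=> k ki; rewrite big1// => l _; rewrite memNset ?mul0r// => Ck.
  by rewrite (cell_unique Ck Cx) eqxx in ki.
rewrite mem_set//; case: (boolP (j != i)) => [ji|/negPn/eqP ij];
  rewrite ?mul1r ?mul0r.
  rewrite (bigD1 j)//= mem_set// !mul1r big1 ?addr0// => k /andP[_ kj].
  rewrite memNset ?mul0r ?mulr0// => Ck.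
  by rewrite (cell_unique Ck Cy) eqxx in kj.
rewrite big1// => k ki; rewrite memNset ?mul0r ?mulr0// => Ck.
by move: ki; rewrite (cell_unique Ck Cy) ij eqxx.
Qed.

(** When no cell contains two points, the indicator that a cell is occupied is
    the number of points in it, and the sum over pairs of cells becomes a sum
    over pairs of points. *)
Lemma total_weight_pairs (X : {fset 'rV[R]_d}) (o : {ffun 'I_n -> bool}) :
  (forall i, o i = (0 < npoints X (C i))%N) ->
  (forall x, x \in X -> exists i, C i x) ->
  (forall i, {in X &, forall x y, C i x -> C i y -> x = y}) ->
  total_weight h o = 2^-1 *
    \sum_(x <- X) \sum_(y <- X | x != y) pair_weight x y.
Proof.
move=> oE Xcov Xsep; rewrite /total_weight; congr (_ * _).
have oI i : (o i)%:R = \sum_(x <- X) (x \in C i)%:R :> R.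
  by rewrite oE occupied_indicator//; exact: Xsep.
transitivity (\sum_i \sum_(j | j != i) \sum_(x <- X) \sum_(y <- X)
    (x \in C i)%:R * ((y \in C j)%:R * h i j)).
  apply: eq_bigr => i _; rewrite /vertex_weight mulr_sumr;
    apply: eq_bigr => j _.
  rewrite !oI mulr_suml; apply: eq_bigr => x _.
  by rewrite -mulr_sumr mulr_suml.
transitivity (\sum_(x <- X) \sum_(y <- X) pair_weight x y).
  under eq_bigr do rewrite exchange_big.
  rewrite exchange_big; apply: eq_bigr => x _.
  under eq_bigr do rewrite exchange_big.
  by rewrite exchange_big.
rewrite big_seq [RHS]big_seq; apply: eq_bigr => x xX.
rewrite (bigID (fun y => x != y))/= [X in _ + X]big1 ?addr0// => y.
rewrite negbK => /eqP <-; have [i Cx] := Xcov x xX.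
by rewrite (pair_weightE Cx Cx) eqxx mul0r.
Qed.

End cell_weights.

(** The weight of a pair of cells, measured at their centres. A pair of points
    at distance at most delta has centres at distance at most delta + 2 * e; the
    minimum keeps the weight below delta ^ tau for these longer edges too. *)
Definition cell_edge (R : realType) (d n : nat) (tau delta e : R)
    (c : 'I_n -> 'rV[R]_d) (i j : 'I_n) : R :=
  (enorm (c i - c j) <= delta + 2 * e)%R%:R *
  Num.min (enorm (c i - c j) `^ tau) (delta `^ tau).

Section cell_edge_theory.
Context (R : realType) (d n : nat) (tau delta e : R) (c : 'I_n -> 'rV[R]_d).

Lemma cell_edge_sym i j : cell_edge tau delta e c i j =
  cell_edge tau delta e c j i.
Proof. by rewrite /cell_edge -(enormN (c i - c j)) opprB. Qed.

Lemma cell_edge_ge0 i j : 0 <= cell_edge tau delta e c i j.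
Proof. by rewrite mulr_ge0// le_min !powR_ge0. Qed.

Lemma cell_edge_le i j : cell_edge tau delta e c i j <=
  delta `^ tau * (enorm (c i - c j) <= delta + 2 * e)%R%:R.
Proof. by rewrite /cell_edge [leRHS]mulrC ler_wpM2l// ge_min lexx orbT. Qed.

End cell_edge_theory.

(** The cells whose centres are within delta + 2 * e of a given centre lie in
    the ball of radius delta + 3 * e around it; its volume controls the
    degrees. *)
Lemma cells_tail (R : realType) (d : nat) (disp : measure_display)
  (T : measurableType disp) (P : probability T R)
  (W : set 'rV[R]_d) (t : R) (eta : T -> {fset 'rV[R]_d})
  (n : nat) (c : 'I_n -> 'rV[R]_d) (C : 'I_n -> set 'rV[R]_d)
  (tau delta e s B a b : R) :
  poisson_process P W t eta -> 0 < t -> borel W -> (volume W < +oo)%E ->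
  (forall i, borel (C i)) -> trivIset [set: 'I_n] C ->
  (forall i x, C i x -> enorm (x - c i) < e) ->
  0 < delta -> 0 < e -> 0 <= s -> 0 < B -> 0 <= a -> a < b ->
  fine (P [set w | total_weight (cell_edge tau delta e c) (occupied eta C w) <=
    a]) *
  (fine (P [set w | b <= total_weight (cell_edge tau delta e c)
    (occupied eta C w)]) -
   t * fine (volume W) *
     (expR (- (s * B)) * expR
       ((expR s - 1) * (t * (kappa R d * (delta + 3 * e) ^+ d))))) <=
  expR (- ((b - a) ^+ 2 / (8 * (delta `^ tau * B) * b))).
Proof.
move=> PP t0 bW W_fin bC tC Ce d0 e0 s0 B0 a0 ab.
pose h := cell_edge tau delta e c.
rewrite (prob_occupied PP t0 bC tC (fun x => total_weight h x <= a) bW).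
rewrite (prob_occupied PP t0 bC tC (fun x => b <= total_weight h x) bW) /=.
have hLam i : \sum_(j | enorm (c i - c j) <= delta + 2 * e) cell_prob W t C j <=
    t * (kappa R d * (delta + 3 * e) ^+ d).
  have r0 : 0 < delta + 3 * e by rewrite addr_gt0// mulr_gt0.
  have -> : kappa R d * (delta + 3 * e) ^+ d =
      fine (volume [set x | enorm (x - c i) <= delta + 3 * e]).
    by rewrite volume_eball.
  apply: (sum_cell_prob_le t0 bC tC bW (eball_borel _ _)
    (volume_eball_fin _ _)).
  move=> j ij x [Cx _] /=; apply: (le_trans (enorm_dist (c j) _ _)).
  have := Ce _ _ Cx; lra.
have hM : \sum_i cell_prob W t C i <= t * fine (volume W).
  by apply: (sum_cell_prob_le t0 bC tC bW bW W_fin) => i _ x [].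
exact: (@bernoulli_graph_tail _ _ h (cell_edge_sym tau delta e c)
  (cell_edge_ge0 tau delta e c) _
  (fun i j => enorm (c i - c j) <= delta + 2 * e) _ _ _ _ _ _ _
  (cell_prob01 t0 bC bW) s0 (powR_gt0 tau d0) B0 a0 ab
  (cell_edge_le tau delta e c) hLam hM).
Qed.

(** * Refining the cells *)

Lemma powR_continuous_at (R : realType) (tau x : R) : 0 < x ->
  {for x, continuous (fun y : R => y `^ tau)}.
Proof.
move=> x0; apply: differentiable_continuous; apply/derivable1_diffP.
by apply: derivable_powR; rewrite in_itv/= x0.
Qed.

Lemma near_fset (I : choiceType) (X : {fset I}) (Q : I -> nat -> Prop) :
  (forall x, x \in X -> \forall n \near \oo, Q x n) ->
  \forall n \near \oo, forall x, x \in X -> Q x n.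
Proof.
move=> h.
have : \oo (\bigcap_(x in [set` X]) [set n | Q x n]).
  by apply: (filter_bigI (F := \oo)) => x xX; exact: h.
by apply: filterS => n hn x xX; exact: hn.
Qed.

Section cells_limit.
Context (R : realType) (d : nat) (W : set 'rV[R]_d) (tau delta : R).
Context (eps : nat -> R) (N : nat -> nat) (c : forall n, 'I_(N n) -> 'rV[R]_d)
  (C : forall n, 'I_(N n) -> set 'rV[R]_d).
Hypothesis C_disj : forall n, trivIset [set: 'I_(N n)] (C (n:=n)).
Hypothesis C_cover : forall n x, W x -> exists i, C (n:=n) i x.
Hypothesis C_small : forall n i x, C (n:=n) i x -> enorm (x - c i) < eps n.
Hypothesis eps_small : forall r : R, 0 < r -> \forall n \near \oo, eps n < r.
Hypothesis tau_ge0 : 0 <= tau.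
Hypothesis delta_gt0 : 0 < delta.

Lemma cells_separate (x y : 'rV[R]_d) : x != y ->
  \forall n \near \oo, forall i, C (n:=n) i x -> ~ C i y.
Proof.
move=> xy; have D0 : 0 < enorm (x - y).
  by rewrite lt_def enorm_ge0 enorm_eq0 subr_eq0 xy.
have D2 : 0 < enorm (x - y) / 2 by rewrite divr_gt0.
near=> n => i Cx Cy.
have := enorm_dist (c i) x y.
have := C_small Cx; have := C_small Cy.
have : eps n < enorm (x - y) / 2 by near: n; exact: eps_small.
lra.
Unshelve. all: by end_near. Qed.

(** The distance of the centres converges to D, the distance of the points. If D
    <= delta the edge is always present and the power is continuous at D > 0; if
    delta < D the edge disappears once the cells are small. *)
Lemma pair_weight_cvg (x y : 'rV[R]_d) : W x -> W y -> x != y ->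
  pair_weight (C (n:=n)) (cell_edge tau delta (eps n) (c (n:=n))) x y
    @[n --> \oo] -->
  (enorm (x - y) <= delta)%R%:R * enorm (x - y) `^ tau.
Proof.
move=> Wx Wy xy; set D := enorm (x - y).
have D0 : 0 < D by rewrite lt_def enorm_ge0 enorm_eq0 subr_eq0 xy.
have tau_cont := @powR_continuous_at R tau D D0.
apply/cvgrPdist_le => /= e e0.
have /cvgrPdist_le/(_ e e0) := tau_cont.
rewrite nearE => /nbhs_ballP[r /= r0 rP].
have r2 : 0 < r / 2 by rewrite divr_gt0.
have far : \forall n \near \oo, delta < D -> eps n < (D - delta) / 4.
  have [h|h] := ltP delta D; last by apply: nearW.
  by apply: filterS (eps_small (_ : 0 < (D - delta) / 4)) => //;
    rewrite divr_gt0// subr_gt0.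
near=> n.
have [i Cx] := @C_cover n x Wx.
have [j Cy] := @C_cover n y Wy.
have ji : j != i.
  apply/eqP => ji; rewrite ji in Cy; move: Cy; move: i Cx {ji}.
  by near: n; exact: cells_separate.
rewrite (pair_weightE _ (C_disj (n:=n)) Cx Cy) ji mul1r /cell_edge.
set D' := enorm (c i - c j).
have DD' : `|D - D'| < 2 * eps n.
  apply: le_lt_trans (ler_dist_enorm _ _) _.
  have -> : x - y - (c i - c j) = (x - c i) - (y - c j).
    by rewrite !opprB addrACA [RHS]addrACA; congr (_ + _); rewrite addrC.
  apply: le_lt_trans (enormD _ _) _; rewrite enormN.
  have := C_small Cx; have := C_small Cy; lra.
have nr : eps n < r / 2 by near: n; exact: eps_small.
have [Dd|Dd] := leP D delta.
  have -> : D' <= delta + 2 * eps n.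
    by move: DD'; rewrite ltr_norml => /andP[]; lra.
  rewrite !mul1r.
  have : `|D `^ tau - D' `^ tau| <= e.
    apply: rP; rewrite /ball/=; apply: (lt_trans DD'); lra.
  have : D `^ tau <= delta `^ tau by apply: ge0_ler_powR => //;
    rewrite nnegrE ltW.
  move: (D `^ tau) (D' `^ tau) (delta `^ tau) => A A' B.
  rewrite !ler_norml => AB /andP[h1 h2]; rewrite minEle;
    case: ifP => [_|/negbT]; first by rewrite h1 h2.
  rewrite -ltNge => AB'; have ABe : - e <= A - B by lra.
  by rewrite ABe /=; lra.
have nd : eps n < (D - delta) / 4 by move: Dd; near: n.
have -> : (D' <= delta + 2 * eps n) = false.
  apply/negbTE; rewrite -ltNge.
  by move: DD'; rewrite ltr_norml => /andP[]; lra.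
by rewrite !mul0r subrr normr0 ltW.
Unshelve. all: by end_near. Qed.

Lemma total_weight_cvg (X : {fset 'rV[R]_d}) (o : forall n,
  {ffun 'I_(N n) -> bool}) :
  (forall x, x \in X -> W x) ->
  (forall n i, o n i = (0 < npoints X (C i))%N) ->
  total_weight (cell_edge tau delta (eps n) (c (n:=n))) (o n) @[n --> \oo] -->
  edge_length tau delta X.
Proof.
move=> XW oE.
have sep : \forall n \near \oo, forall x y, x \in X -> y \in X -> x != y ->
    forall i, C (n:=n) i x -> ~ C i y.
  have : \forall n \near \oo, forall x, x \in X -> forall y, y \in X ->
    x != y ->
      forall i, C (n:=n) i x -> ~ C i y.
    apply: near_fset => x xX; apply: near_fset => y yX.
    have [->|xy] := eqVneq x y; first by apply: nearW.
    by apply: filterS (cells_separate xy) => n hn _; exact: hn.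
  by apply: filterS => n hn x y xX; exact: hn.
apply: (@cvg_trans _ ((2^-1 * \sum_(x <- X) \sum_(y <- X | x != y)
    pair_weight (C (n:=n)) (cell_edge tau delta (eps n) (c (n:=n))) x y)
      @[n --> \oo])).
  apply: near_eq_cvg; near=> n.
  apply/esym/total_weight_pairs => //.
  - by move=> x /XW; exact: C_cover.
  - move=> i x y xX yX Cx Cy; apply/eqP; apply: contraT => xy.
    have sepn : forall x y, x \in X -> y \in X -> x != y ->
      forall i, C (n:=n) i x -> ~ C i y by near: n.
    by have := sepn _ _ xX yX xy _ Cx Cy.
apply: cvgMr; rewrite big_seq; under eq_cvg do rewrite big_seq.
apply: cvg_big => [|x xX]; first exact: add_continuous.
rewrite big_seq_cond; under eq_cvg do rewrite big_seq_cond.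
apply: cvg_big => [|y /andP[yX xy]]; first exact: add_continuous.
by apply: pair_weight_cvg => //; exact: XW.
Unshelve. all: by end_near. Qed.

End cells_limit.

Section limit_in_law.
Context (R : realType) (disp : measure_display) (T : measurableType disp)
  (P : probability T R).

Lemma fine_probability_cover (A B C : set T) :
  measurable A -> measurable B -> measurable C -> A `<=` B `|` C ->
  fine (P A) <= fine (P B) + fine (P C).
Proof.
move=> mA mB mC ABC.
rewrite -fineD ?fin_num_measure// fine_le ?fin_num_measure//.
  by rewrite fin_numD !fin_num_measure.
apply: (@le_trans _ _ (P (B `|` C))); last exact: measureU2.
by apply: le_measure; rewrite ?inE//; exact: measurableU.
Qed.

Lemma fine_probability01 (A : set T) : measurable A -> 0 <= fine (P A) <= 1.
Proof.
move=> mA; rewrite fine_ge0//= -lee_fin fineK ?fin_num_measure//.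
exact: probability_le1.
Qed.

Lemma measurable_le_cst (F : T -> R) a : measurable_fun setT F ->
  measurable [set w | F w <= a].
Proof.
move=> mF; rewrite (_ : [set w | _] = setT `&` F @^-1` `]-oo, a]%classic).
  exact: mF.
by rewrite setTI; apply/seteqP; split => w /=; rewrite in_itv.
Qed.

Lemma measurable_ge_cst (F : T -> R) a : measurable_fun setT F ->
  measurable [set w | a <= F w].
Proof.
move=> mF; rewrite (_ : [set w | _] = setT `&` F @^-1` `[a, +oo[%classic).
  exact: mF.
by rewrite setTI; apply/seteqP; split => w /=; rewrite in_itv/= ?andbT.
Qed.

Context (F : nat -> T -> R) (F0 : T -> R).
Hypothesis mF : forall n, measurable_fun setT (F n).
Hypothesis F_cvg : forall w, F n w @[n --> \oo] --> F0 w.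

Lemma limit_measurable : measurable_fun setT F0.
Proof. by apply: measurable_fun_cvg mF _ => w _; exact: F_cvg. Qed.

(** Pointwise convergence implies convergence in probability. *)
Lemma eventually_close (eta r : R) : 0 < eta -> 0 < r ->
  \forall n \near \oo, exists A, [/\ measurable A, fine (P A) < r &
    forall w, ~ A w -> `|F n w - F0 w| <= eta].
Proof.
move=> eta0 r0.
pose D n : set T := [set w | `|F n w - F0 w| <= eta].
have mD n : measurable (D n).
  apply: measurable_le_cst; apply: measurableT_comp => //.
  by apply: measurable_funB => //; exact: limit_measurable.
pose A n : set T := \bigcap_(k in [set k | (n <= k)%N]) D k.
have mA n : measurable (A n) by apply: bigcap_measurable => [|k _];
  [exists n => /=|exact: mD].
have AT : \bigcup_n A n = setT.
  apply/seteqP; split => // w _.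
  have /cvgrPdist_le/(_ eta eta0)[N _ h] := @F_cvg w.
  by exists N => // k /= Nk; rewrite /D/= distrC; exact: h.
have : (P \o A) n @[n --> \oo] --> P (\bigcup_n A n).
  apply: nondecreasing_cvg_mu => //; first by rewrite AT.
  move=> n m nm; apply/subsetPset => w h k /= mk; apply: h => /=.
  exact: leq_trans mk.
rewrite AT probability_setT => /fine_cvgP[_ /cvgrPdist_lt/(_ r r0)].
apply: filterS => n /=; rewrite ltr_norml => /andP[_ h].
exists (~` A n); split; first exact: measurableC.
  rewrite probability_setC// fineB ?fin_num_measure//.
by move=> w /contrapT h'; apply: h' => /=.
Qed.

(** Up to an event of small probability, F0 <= a implies F n <= a + eta, and b
    <= F0 implies b - eta <= F n. First n tends to infinity, then eta to 0. *)
Lemma tail_limit (q : nat -> R) (q0 : R) (G : R -> R -> R) (a b : R) :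
  (forall n, 0 <= q n) -> q n @[n --> \oo] --> q0 ->
  (forall a' b', 0 <= G a' b') ->
  (forall n a' b', 0 <= a' -> a' < b' ->
    fine (P [set w | F n w <= a']) * (fine (P [set w | b' <= F n w]) - q n) <=
      G a' b') ->
  0 <= a -> a < b -> G (a + x) (b - x) @[x --> 0] --> G a b ->
  fine (P [set w | F0 w <= a]) * (fine (P [set w | b <= F0 w]) - q0) <= G a b.
Proof.
move=> q_ge0 q_cvg G0 tail a0 ab G_cvg; have mF0 := limit_measurable.
have step eta : 0 < eta -> a + eta < b - eta ->
    fine (P [set w | F0 w <= a]) * (fine (P [set w | b <= F0 w]) - q0) <=
    G (a + eta) (b - eta).
  move=> eta0 abeta; apply/ler_addgt0Pr => e e0; pose r : R := e / 3.
  have r0 : 0 < r by rewrite divr_gt0.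
  have er : e = r * 3 by rewrite divfK.
  have : \forall n \near \oo, q n < q0 + r.
    have /cvgrPdist_lt/(_ r r0) := q_cvg; apply: filterS => n.
    by rewrite ltr_norml => /andP[]; lra.
  have := eventually_close eta0 r0 =>
    /filterI/[apply]/filter_ex[n [[A [mA Ar Aclose]] qr]].
  have aeta0 : 0 <= a + eta by rewrite addr_ge0// ltW.
  have := tail n _ _ aeta0 abeta.
  have ha : fine (P [set w | F0 w <= a]) <=
    fine (P [set w | F n w <= a + eta]) + fine (P A).
    apply: fine_probability_cover => //; try exact: measurable_le_cst.
    move=> w /= Fa; have [Aw|/Aclose] := pselect (A w); first by right.
    by rewrite ler_norml => /andP[? ?]; left => /=; lra.
  have hb : fine (P [set w | b <= F0 w]) <=
    fine (P [set w | b - eta <= F n w]) + fine (P A).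
    apply: fine_probability_cover => //; try exact: measurable_ge_cst.
    move=> w /= Fa; have [Aw|/Aclose] := pselect (A w); first by right.
    by rewrite ler_norml => /andP[? ?]; left => /=; lra.
  have /andP[] := fine_probability01 (measurable_le_cst a mF0).
  have /andP[] := fine_probability01 (measurable_ge_cst (b - eta) (mF n)).
  move: ha hb (q_ge0 n) qr (G0 (a + eta) (b - eta)) Ar; rewrite er.
  move: (fine (P [set w | F0 w <= a])) (fine (P [set w | F n w <= a + eta])) =>
    al aln.
  move: (fine (P [set w | b <= F0 w])) (fine (P [set w | b - eta <= F n w])) =>
    be ben.
  move: (G _ _) (q n) (fine (P A)) =>
    g qn pA ha hb qn0 qr g0 pAr ben0 ben1 al0 al1 h.
  have h1 : al * (be - q0) <= al * (ben - qn) + 2 * r.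
    have : al * (be - q0) <= al * (ben - qn + 2 * r) by apply: ler_wpM2l => //;
      lra.
    have : al * (2 * r) <= 1 * (2 * r) by apply: ler_wpM2r => //; lra.
    lra.
  apply: (le_trans h1); have [neg|pos] := leP (ben - qn) 0.
    have := mulr_ge0_le0 al0 neg; lra.
  have : al * (ben - qn) <= (aln + r) * (ben - qn) by apply: ler_wpM2r; lra.
  have : r * (ben - qn) <= r * 1 by apply: ler_wpM2l; lra.
  lra.
apply/ler_addgt0Pr => e e0.
have G_right : G (a + x) (b - x) @[x --> 0^'+] --> G a b
  by exact: cvg_at_right_filter.
have /cvgrPdist_le/(_ e e0) near_G := G_right.
have ab4 : 0 < (b - a) / 4 by rewrite divr_gt0// subr_gt0.
near (0 : R)^'+ => x.
have x0 : 0 < x by near: x; exact: nbhs_right_gt.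
have x4 : x < (b - a) / 4 by near: x; exact: nbhs_right_lt.
apply: (le_trans (step x x0 _)); first lra.
have : `|G a b - G (a + x) (b - x)| <= e by near: x.
by rewrite ler_norml => /andP[]; lra.
Unshelve. all: by end_near. Qed.

End limit_in_law.

Section poisson_limit.
Context (R : realType) (d : nat) (disp : measure_display)
  (T : measurableType disp) (P : probability T R)
  (W : set 'rV[R]_d) (t : R) (eta : T -> {fset 'rV[R]_d}) (tau delta : R).
Hypothesis eta_poisson : poisson_process P W t eta.
Hypothesis t_gt0 : 0 < t.
Hypothesis W_compact : compact W.
Hypothesis tau_ge0 : 0 <= tau.
Hypothesis delta_gt0 : 0 < delta.

Lemma compact_borel : borel W.
Proof.
by apply: closed_borel; apply: compact_closed => //; exact: norm_hausdorff.
Qed.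

Lemma compact_norm_bounded : exists M : R, forall x, W x -> `|x| <= M.
Proof.
have [M [_ h]] := compact_bounded W_compact.
by exists (M + 1) => x Wx; apply: (h (M + 1)) => //; rewrite ltrDl.
Qed.

(** As the mesh goes to zero the weight of the occupied cells converges, at each
    outcome, to the edge length of the point set, and the radius delta + 3 * e in
    the degree bound shrinks to delta; so the inequality for the cells passes to
    the limit. *)
Lemma poisson_edge_length_tail :
  measurable_fun setT (fun w => edge_length tau delta (eta w)) /\
  forall s B a b, 0 <= s -> 0 < B -> 0 <= a -> a < b ->
  fine (P [set w | edge_length tau delta (eta w) <= a]) *
  (fine (P [set w | b <= edge_length tau delta (eta w)]) -
   t * fine (volume W) *
     (expR (- (s * B)) * expR ((expR s - 1) * (t * (kappa R d * delta ^+ d)))))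
       <=
  expR (- ((b - a) ^+ 2 / (8 * (delta `^ tau * B) * b))).
Proof.
have [M WM] := compact_norm_bounded.
have bW := compact_borel.
have W_fin := volume_bounded bW WM.
pose eps n : R := n.+1%:R^-1.
have eps_gt0 n : 0 < eps n by rewrite invr_gt0.
pose cells := {n & (('I_n -> 'rV[R]_d) * ('I_n -> set 'rV[R]_d))%type}.
have /choice[S hS] n : exists S : cells, [/\ forall i, borel ((projT2 S).2 i),
    trivIset setT (projT2 S).2, forall x, W x -> exists i, (projT2 S).2 i x &
    forall i x, (projT2 S).2 i x -> enorm (x - (projT2 S).1 i) < eps n].
  have [k [c [C [h1 h2 h3 h4]]]] := compact_cells W_compact (eps_gt0 n).
  by exists (existT _ k (c, C)).
pose N n := projT1 (S n).
pose c n : 'I_(N n) -> 'rV[R]_d := (projT2 (S n)).1.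
pose C n : 'I_(N n) -> set 'rV[R]_d := (projT2 (S n)).2.
have C_borel n i : borel (C n i) by have [h _ _ _] := hS n; exact: h.
have C_disj n : trivIset setT (C n) by have [_ h _ _] := hS n.
have C_cover n x : W x -> exists i, C n i x by have [_ _ h _] := hS n; exact: h.
have C_small n i x : C n i x -> enorm (x - c n i) < eps n.
  by have [_ _ _ h] := hS n; exact: h.
pose F n w := total_weight (cell_edge tau delta (eps n) (c n))
  (occupied eta (C n) w).
have eps_small (r : R) : 0 < r -> \forall n \near \oo, eps n < r.
  by move=> r0; exact: (near_infty_natSinv_lt (PosNum r0)).
have mF n : measurable_fun setT (F n).
  move=> _ Y mY; rewrite setTI.
  have := @measurable_occupied _ _ _ _ _ _ _ _ eta_poisson _ _ (C_borel n)
    (fun x => total_weight (cell_edge tau delta (eps n) (c n)) x \in Y).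
  by congr measurable; apply/seteqP; split => w /=; rewrite in_setE.
have F_cvg w : F n w @[n --> \oo] --> edge_length tau delta (eta w).
  apply: (total_weight_cvg C_disj C_cover C_small eps_small tau_ge0 delta_gt0).
    by move=> x; exact: (pp_support eta_poisson).
  by move=> n i; rewrite ffunE.
split; first exact: (limit_measurable mF F_cvg).
move=> s B a b s0 B0 a0 ab.
pose q e : R := t * fine (volume W) *
  (expR (- (s * B)) * expR
    ((expR s - 1) * (t * (kappa R d * (delta + 3 * e) ^+ d)))).
pose G a' b' : R := expR (- ((b' - a') ^+ 2 / (8 * (delta `^ tau * B) * b'))).
have eps_cvg : eps n @[n --> \oo] --> (0 : R).
  apply/cvgrPdist_lt => e e0; apply: filterS (eps_small e e0) => n.
  by rewrite sub0r normrN gtr0_norm.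
have q0E : q 0 = t * fine (volume W) *
    (expR (- (s * B)) * expR ((expR s - 1) * (t * (kappa R d * delta ^+ d)))).
  by rewrite /q mulr0 addr0.
rewrite -q0E -/(G a b).
have q_cvg : (q \o eps) n @[n --> \oo] --> q 0.
  apply: cvgMr; apply: cvgMr; apply: (@continuous_cvg _ _ _ _ _ _ (@expR R));
    first exact: continuous_expR.
  apply: cvgMr; apply: cvgMr; apply: cvgMr.
  apply: (@continuous_cvg _ _ _ _ _ _ (fun z : R => z ^+ d)).
    exact: exprn_continuous.
  by apply: cvgD; [exact: cvg_cst|exact: cvgMr].
have G_cvg : G (a + x) (b - x) @[x --> 0] --> G a b.
  have : G (a + x) (b - x) @[x --> 0] --> G (a + 0) (b - 0).
    have xa : (a + x : R) @[x --> 0] --> a + 0.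
      by apply: cvgD; [exact: cvg_cst|exact: cvg_id].
    have xb : (b - x : R) @[x --> 0] --> b - 0.
      by apply: cvgB; [exact: cvg_cst|exact: cvg_id].
    apply: (@continuous_cvg _ _ _ _ _ _ (@expR R));
      first exact: continuous_expR.
    apply: cvgN; apply: cvgM.
      apply: (@continuous_cvg _ _ _ _ _ _ (fun z : R => z ^+ 2)).
        exact: exprn_continuous.
      exact: cvgB.
    apply: cvgV; last exact: cvgMr.
    have b0 : 0 < b by exact: le_lt_trans ab.
    have tau0 : 0 < delta `^ tau by exact: powR_gt0.
    by rewrite subr0 gt_eqF// mulr_gt0// mulr_gt0// mulr_gt0.
  by rewrite addr0 subr0.
have q_ge0 n : 0 <= (q \o eps) n.
  apply: mulr_ge0; last by apply: mulr_ge0; exact: expR_ge0.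
  by rewrite mulr_ge0 ?(ltW t_gt0)// fine_ge0// volume_ge0.
apply: (tail_limit mF F_cvg q_ge0 q_cvg _ _ a0 ab G_cvg).
  by move=> a' b'; exact: expR_ge0.
move=> n a' b' a'0 a'b'.
rewrite /G /q /F.
have h := cells_tail tau eta_poisson t_gt0 bW W_fin (C_borel n) (C_disj n)
  (C_small n) delta_gt0 (eps_gt0 n) s0 B0 a'0 a'b'.
exact: h.
Qed.

End poisson_limit.

(** * From the tail inequality to deviations from the median *)

Lemma expR1_le3 (R : realType) : expR 1 <= 3 :> R.
Proof.
have h : 7 / 8 <= expR (- 8^-1) :> R by apply: le_trans (expR_ge1Dx _); lra.
have -> : (1 : R) = 8%:R * 8^-1 by rewrite divff.
rewrite expRM_natl -[8^-1]opprK expRN exprVn.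
have h8 : (7 / 8) ^+ 8 <= expR (- 8^-1) ^+ 8 :> R.
  by rewrite ler_pXn2r// ?nnegrE ?expR_ge0// divr_ge0.
rewrite -[leRHS]invrK lef_pV2 ?posrE ?exprn_gt0 ?expR_gt0//; apply: le_trans h8.
by rewrite -subr_ge0; lra.
Qed.

(** x is the positive root of x ^ 2 - 2 * a * x = c / (lam * s), which says that
    the two exponents agree. *)
Lemma chernoff_balance (R : realType) (M lam s c : R) :
  0 < M -> 0 < lam -> 0 < s -> 0 < c ->
  let a := (ln M + lam * (expR s - 1)) / (2 * lam * s) in
  let x := a + Num.sqrt (c / (lam * s) + a ^+ 2) in
  0 < x /\ M * (expR (- (s * (lam * x))) * expR ((expR s - 1) * lam)) =
    expR (- (c / x)).
Proof.
move=> M0 lam0 s0 c0 a x.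
have b0 : 0 < c / (lam * s) by rewrite divr_gt0// mulr_gt0.
have r0 : 0 <= c / (lam * s) + a ^+ 2 by rewrite addr_ge0 ?sqr_ge0 ?ltW.
have x0 : 0 < x.
  rewrite /x -ltrBlDl sub0r; apply: (@le_lt_trans _ _ (Num.sqrt (a ^+ 2))).
    by rewrite sqrtr_sqr -normrN ler_norm.
  by rewrite ltr_sqrt ?ltrDr// ltr_wpDr// sqr_ge0.
have xa : x ^+ 2 - 2 * a * x = c / (lam * s).
  transitivity (Num.sqrt (c / (lam * s) + a ^+ 2) ^+ 2 - a ^+ 2);
    first by rewrite /x; ring.
  by rewrite sqr_sqrtr// addrK.
split=> //; rewrite -{1}(lnK M0) -2!expRD; congr expR.
have -> : ln M = 2 * lam * s * a - lam * (expR s - 1).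
  by rewrite /a mulrC divfK ?addrK// gt_eqF// !mulr_gt0.
have -> : c = (x ^+ 2 - 2 * a * x) * (lam * s).
  by rewrite xa divfK// gt_eqF// mulr_gt0.
by field; rewrite gt_eqF.
Qed.

Section median_deviation.
Context (R : realType) (disp : measure_display) (T : measurableType disp)
  (P : probability T R) (L : T -> R) (m u H B q : R).
Hypothesis mL : measurable_fun setT L.
Hypothesis L_ge0 : forall w, 0 <= L w.
Hypothesis m_median : is_median P L m.
Hypothesis u_gt0 : 0 < u.
Hypothesis K_gt0 : 0 < H * B.

Lemma median_ge0 : 0 <= m.
Proof.
rewrite leNgt; apply/negP => m0; have [h _] := m_median.
move: h; rewrite (_ : [set w | _] = set0).
  by rewrite measure0 lee_fin leNgt invr_gt0 ltr0n.
by apply/seteqP; split => // w /=; rewrite leNgt (lt_le_trans m0).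
Qed.

(** If q >= 1/8 the bound is trivial. Otherwise the instance (m, m + u) of the
    tail inequality multiplies the probability of the upper tail, less q, by at
    least 1/2, and the instance (m - u, m) multiplies that of the lower tail by
    at least 1/2 - 1/8; so each tail has probability at most 3 * q. *)
Lemma median_deviation :
  (forall a b, 0 <= a -> a < b ->
    fine (P [set w | L w <= a]) * (fine (P [set w | b <= L w]) - q) <=
    expR (- ((b - a) ^+ 2 / (8 * (H * B) * b)))) ->
  q = expR (- (u ^+ 2 / (8 * (H * B) * (u + m)))) ->
  fine (P [set w | u <= `|L w - m|]) <= 8 * q.
Proof.
move=> tail qE; have m0 := median_ge0.
have q0 : 0 < q by rewrite qE expR_gt0.
have mle a := measurable_le_cst a mL; have mge a := measurable_ge_cst a mL.
have mdev : measurable [set w | u <= `|L w - m|].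
  apply: measurable_ge_cst; apply: measurableT_comp => //.
  exact: measurable_funB.
have /andP[dev0 dev1] := fine_probability01 P mdev.
have [q8|q8] := leP (1 / 8) q; first by lra.
have [hle hge] := m_median.
have {}hle : 2^-1 <= fine (P [set w | L w <= m]).
  by rewrite -lee_fin fineK// fin_num_measure.
have {}hge : 2^-1 <= fine (P [set w | m <= L w]).
  by rewrite -lee_fin fineK// fin_num_measure.
have up : fine (P [set w | m + u <= L w]) <= 3 * q.
  have : fine (P [set w | L w <= m]) * (fine (P [set w | m + u <= L w]) - q) <=
    q.
    apply: le_trans (tail m (m + u) m0 _) _; first by rewrite ltrDl.
    by rewrite qE addrAC subrr add0r [m + u]addrC.
  have [neg _|pos h] := leP (fine (P [set w | m + u <= L w]) - q) 0; first lra.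
  have : 2^-1 * (fine (P [set w | m + u <= L w]) - q) <= q.
    by apply: le_trans h; rewrite ler_wpM2r// ltW.
  lra.
have down : fine (P [set w | L w <= m - u]) <= 3 * q.
  (* For m < u the lower tail is empty since L is nonnegative. *)
  have [um|mu] := leP u m; last first.
    rewrite (_ : [set w | _] = set0);
      first by rewrite measure0/= mulr_ge0// ltW.
    apply/seteqP; split => // w /=; rewrite leNgt.
    by rewrite (lt_le_trans _ (L_ge0 w))// subr_lt0.
  have mgt0 : 0 < m by exact: lt_le_trans um.
  have : fine (P [set w | L w <= m - u]) * (fine (P [set w | m <= L w]) - q) <=
    q.
    apply: le_trans (tail (m - u) m _ _) _;
      [by rewrite subr_ge0|by rewrite gtrBl|].
    have -> : m - (m - u) = u by ring.
    rewrite qE ler_expR lerN2 ler_pM2l ?exprn_gt0//.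
    have K8 : 0 < 8 * (H * B) by rewrite mulr_gt0.
    rewrite lef_pV2 ?posrE ?(mulr_gt0 K8)// ?addr_gt0//.
    by rewrite ler_pM2l// lerDr ltW.
  have /andP[p0 _] := fine_probability01 P (mle (m - u)).
  have : fine (P [set w | L w <= m - u]) * (3 / 8) <=
      fine (P [set w | L w <= m - u]) * (fine (P [set w | m <= L w]) - q).
    by rewrite ler_wpM2l//; lra.
  move=> h1 h2; have := le_trans h1 h2; lra.
have : fine (P [set w | u <= `|L w - m|]) <=
    fine (P [set w | m + u <= L w]) + fine (P [set w | L w <= m - u]).
  apply: fine_probability_cover => // w /=.
  by rewrite ler_normr => /orP[h|h]; [left|right] => /=; lra.
lra.
Qed.

End median_deviation.

(** The bound passes to the infimum by monotonicity. If the infimum is 0, the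
    exponent is c / 0 = 0 and the right side is 8. *)
Lemma le_expR_inf (R : realType) (S : set R) (c p : R) :
  0 < c -> p <= 8 -> S !=set0 -> (forall x, S x -> 0 < x) ->
  (forall x, S x -> p <= 8 * expR (- (c / x))) ->
  p <= 8 * expR (- (c / inf S)).
Proof.
move=> c0 p8 S0 Spos Sp.
have lbS : lbound S 0 by move=> x /Spos /ltW.
have inf0 : 0 <= inf S by exact: lb_le_inf.
have [<-|infpos] := eqVneq 0 (inf S);
  first by rewrite invr0 mulr0 oppr0 expR0 mulr1.
have {}infpos : 0 < inf S by rewrite lt_def eq_sym infpos.
have [p0|p0] := leP p 0; first by rewrite (le_trans p0)// mulr_ge0// expR_ge0.
have p80 : 0 < p / 8 by rewrite divr_gt0.
have lnS x : S x -> c / x <= - ln (p / 8).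
  move=> Sx; rewrite lerNr -ler_expR lnK ?posrE// ler_pdivrMr// mulrC;
    exact: Sp.
have lnpos : 0 < - ln (p / 8).
  by have [x Sx] := S0; apply: lt_le_trans (lnS x Sx); rewrite divr_gt0// Spos.
have h : c / - ln (p / 8) <= inf S.
  apply: lb_le_inf => // x Sx; rewrite ler_pdivrMr// mulrC -ler_pdivrMr ?Spos//.
  exact: lnS.
have : c / inf S <= - ln (p / 8).
  by rewrite ler_pdivrMr// mulrC -ler_pdivrMr.
rewrite lerNr => h'; rewrite mulrC -ler_pdivrMr// -[leLHS]lnK ?posrE//.
by rewrite ler_expR.
Qed.

(** Write K for the denominator of c. From x <= a + |a| + sqrt (c / lam) and exp
    1 - 1 <= 2 one gets K * x <= (C * v + u * D * sqrt v) / 2, which is at most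
    the larger of C * v and u * D * sqrt v. *)
Lemma min_exponent (R : realType) (l lam H v u : R) :
  0 < lam -> 0 < H -> 0 < v -> 0 < u ->
  let c := u ^+ 2 / (8 * lam * H * v) in
  let C := 16 * (l * H + 2 * lam * H) in
  let D := 4 * Num.sqrt (2 * H) in
  let a := (l + lam * (expR 1 - 1)) / (2 * lam * 1) in
  let x := a + Num.sqrt (c / (lam * 1) + a ^+ 2) in
  0 < C -> 0 < x ->
  Num.min (u ^+ 2 / (C * v)) (u / (D * Num.sqrt v)) <= c / x.
Proof.
move=> lam0 H0 v0 u0 c C D a x C0 x0.
have K0 : 0 < 8 * lam * H * v by rewrite !mulr_gt0.
have D0 : 0 < D by rewrite mulr_gt0// sqrtr_gt0 mulr_gt0.
have v'0 : 0 < Num.sqrt v by rewrite sqrtr_gt0.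
pose z := u * D * Num.sqrt v / (2 * (8 * lam * H * v)).
have z0 : 0 <= z by rewrite divr_ge0 ?mulr_ge0// ltW.
(* z is the square root of c / lam, written in terms of D. *)
have zE : c / (lam * 1) = z ^+ 2.
  rewrite /z /c expr_div_n !exprMn !sqr_sqrtr ?mulr_ge0 ?ltW//.
  by field; rewrite !gt_eqF.
have xle : x <= a + `|a| + z.
  rewrite /x zE -addrA lerD2l -(@ler_pXn2r _ 2)// ?nnegrE ?sqrtr_ge0
    ?addr_ge0//.
  rewrite sqr_sqrtr ?addr_ge0 ?sqr_ge0// sqrrD real_normK ?num_real//.
  rewrite addrC lerD2r lerDl mulrn_wge0// mulr_ge0//.
have aC : (8 * lam * H * v) * (a + `|a|) <= C * v / 2.
  have [a0|a0] := leP 0 a;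
    last by rewrite ltr0_norm// subrr mulr0 divr_ge0// mulr_ge0 ?ltW.
  rewrite ger0_norm//.
  have -> : (8 * lam * H * v) * (a + a) = 8 * H * v * (l + lam * (expR 1 - 1)).
    by rewrite /a; field; rewrite gt_eqF.
  have : 8 * H * v * (l + lam * (expR 1 - 1)) <= 8 * H * v * (l + lam * 2).
    rewrite ler_pM2l ?mulr_gt0// lerD2l ler_pM2l// lerBlDr.
    by apply: le_trans (expR1_le3 R) _; lra.
  rewrite /C; lra.
have Kx : (8 * lam * H * v) * x <= C * v / 2 + u * D * Num.sqrt v / 2.
  apply: (@le_trans _ _ ((8 * lam * H * v) * (a + `|a| + z))).
    by rewrite ler_pM2l.
  rewrite mulrDr lerD// le_eqVlt; apply/orP; left; apply/eqP.
  by rewrite /z; field; rewrite !gt_eqF.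
have -> : c / x = u ^+ 2 / ((8 * lam * H * v) * x).
  by rewrite /c; field; rewrite !gt_eqF.
have Cv0 : 0 < C * v by rewrite mulr_gt0.
have Dv0 : 0 < D * Num.sqrt v by rewrite mulr_gt0.
have Kx0 : 0 < (8 * lam * H * v) * x by rewrite mulr_gt0.
rewrite ge_min; have [le|lt] := leP (u * D * Num.sqrt v) (C * v).
  apply/orP; left; rewrite ler_pM2l ?exprn_gt0// lef_pV2 ?posrE//; lra.
apply/orP; right; have -> : u / (D * Num.sqrt v) =
  u ^+ 2 / (u * D * Num.sqrt v).
  by field; rewrite !gt_eqF.
have uD0 : 0 < u * D * Num.sqrt v by rewrite -mulrA mulr_gt0.
rewrite ler_pM2l ?exprn_gt0// lef_pV2 ?posrE//; lra.
Qed.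

Theorem theorem6p2 (R : realType) (d : nat) (d_ge1 : (1 <= d)%N)
    (W : set 'rV[R]_d)
    (W_compact : compact W)
    (W_convex : convex_set (W : set (convex_lmodType 'rV[R]_d)))
    (W_pos : (0 < volume W)%E)
    (delta : R -> R)
    (delta_pos : forall t, 0 < t -> 0 < delta t)
    (delta_cvg : delta t @[t --> +oo] --> (0 : R))
    (t : R) (t_pos : 0 < t)
    (disp : measure_display) (T : measurableType disp) (P : probability T R)
    (eta : T -> {fset 'rV[R]_d})
    (eta_poisson : poisson_process P W t eta)
    (tau : R) (tau_ge0 : 0 <= tau) (m : R)
    (m_median : is_median P (fun w => edge_length tau (delta t) (eta w)) m)
    (u : R) (u_pos : 0 < u) :
  let V := fine (volume W) in
  let k := kappa R d in
  let dev := P [set w | u <= `|edge_length tau (delta t) (eta w) - m| ] in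
  let C := 16 * (ln (t * V) * delta t `^ tau
                 + 2 * t * k * delta t `^ (d%:R + tau)) in
  let D := 4 * Num.sqrt (2 * delta t `^ tau) in
  (dev <= (8 * expR (- (u ^+ 2 /
             (8 * t * k * delta t `^ (d%:R + tau) *
              xstar d tau V k t (delta t) m u * (u + m)))))%:E)%E /\
  (dev <= (8 * expR (- Num.min (u ^+ 2 / (C * (u + m)))
                               (u / (D * Num.sqrt (u + m)))))%:E)%E.
Proof.
have dl0 := delta_pos t t_pos.
move: (delta t) dl0 m_median => dl dl0 m_median V k dev C D.
have [M WM] := compact_norm_bounded W_compact.
have bW := compact_borel W_compact.
have W_fin := volume_bounded bW WM.
have V0 : 0 < V.
  by rewrite /V -lte_fin fineK// ge0_fin_numE ?(ltW W_pos).
have k0 : 0 < k by exact: kappa_gt0 bW WM W_pos.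
pose L w := edge_length tau dl (eta w).
have [mL tail] := poisson_edge_length_tail eta_poisson t_pos W_compact tau_ge0
  dl0.
have L_ge0 w : 0 <= L w.
  rewrite mulr_ge0// sumr_ge0// => x _; rewrite sumr_ge0// => y _.
  by rewrite mulr_ge0// powR_ge0.
have m0 := median_ge0 L_ge0 m_median.
pose H := dl `^ tau; have H0 : 0 < H by exact: powR_gt0.
pose lam := t * k * dl ^+ d.
have lam0 : 0 < lam by rewrite mulr_gt0 ?exprn_gt0// mulr_gt0.
have tV0 : 0 < t * V by exact: mulr_gt0.
have um0 : 0 < u + m by rewrite ltr_wpDr.
have dlD : dl `^ (d%:R + tau) = dl ^+ d * H.
  by rewrite powRD ?powR_mulrn ?ltW// (gt_eqF dl0) implybT.
have dlDD : dl `^ ((2 * d)%:R + tau) = (dl ^+ d) ^+ 2 * H.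
  by rewrite powRD ?powR_mulrn ?ltW ?(gt_eqF dl0) ?implybT// mulnC exprM.
pose c := u ^+ 2 / (8 * lam * H * (u + m)).
have c0 : 0 < c.
  by rewrite divr_gt0 ?exprn_gt0// mulr_gt0 // mulr_gt0 // mulr_gt0.
pose a s := (ln (t * V) + lam * (expR s - 1)) / (2 * lam * s).
pose x s := a s + Num.sqrt (c / (lam * s) + a s ^+ 2).
have mdev : measurable [set w | u <= `|L w - m|].
  apply: measurable_ge_cst; apply: measurableT_comp => //.
  exact: measurable_funB.
have devE : dev = (fine (P [set w | u <= `|L w - m|]))%:E.
  by rewrite fineK ?fin_num_measure.
have dev_x s : 0 < s -> 0 < x s /\
    fine (P [set w | u <= `|L w - m|]) <= 8 * expR (- (c / x s)).
  move=> s0; have [x0 balance] := chernoff_balance tV0 lam0 s0 c0.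
  rewrite -/(a s) -/(x s) in x0 balance; split => //; rewrite -balance.
  have B0 : 0 < lam * x s by exact: mulr_gt0.
  apply: (median_deviation mL L_ge0 m_median u_pos (mulr_gt0 H0 B0)).
    move=> a' b' a'0 ab'.
    have := tail s (lam * x s) a' b' (ltW s0) B0 a'0 ab'.
    by rewrite (_ : t * (kappa R d * dl ^+ d) = lam) // /lam mulrA.
  rewrite balance; congr (expR (- _)); rewrite /c.
  by field; rewrite !gt_eqF.
have dev8 : fine (P [set w | u <= `|L w - m|]) <= 8.
  by have /andP[_ h] := fine_probability01 P mdev; apply: le_trans h _;
    rewrite ler1n.
split; rewrite devE lee_fin.
  have -> : xstar d tau V k t dl m u = inf [set x s | s in [set s : R | 0 < s]].
    rewrite /xstar; congr inf; apply: eq_imagel => s /= s0.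
    have aE : (ln (t * V) + t * k * dl ^+ d * (expR s - 1)) /
        (2 * t * k * dl ^+ d * s) = a s by rewrite /a /lam !mulrA.
    rewrite aE /x; congr (_ + Num.sqrt (_ + _)); rewrite dlDD /c /lam.
    by field; rewrite !gt_eqF ?exprn_gt0.
  have -> y : u ^+ 2 / (8 * t * k * dl `^ (d%:R + tau) * y * (u + m)) = c / y.
    by rewrite dlD /c /lam -[RHS]mulrA -invfM; congr (_ / _); ring.
  apply: le_expR_inf => //.
  - by exists (x 1), 1 => /=.
  - by move=> _ [s /= s0 <-]; have [] := dev_x s s0.
  - by move=> _ [s /= s0 <-]; have [] := dev_x s s0.
have CE : C = 16 * (ln (t * V) * H + 2 * lam * H).
  by rewrite /C dlD -/H /lam; ring.
have [x0 dev1] := dev_x 1 ltr01.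
(* For C <= 0, which includes the division by C = 0, the minimum is nonpositive
   and the bound is at least 8. *)
have [C0|C0] := ltP 0 C.
  apply: (le_trans dev1); rewrite ler_pM2l// ler_expR lerN2 CE.
  apply: (min_exponent lam0 H0 um0 u_pos) => //.
  by rewrite -CE.
apply: (le_trans dev8); rewrite ler_peMr// -expR0 ler_expR oppr_ge0 ge_min.
by rewrite mulr_ge0_le0 ?sqr_ge0// invr_le0 mulr_le0_ge0// ltW.
Qed.
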